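(* Let $E$ be an AM-space and let $(e^{tA})_{t\geq 0}$ be an individually eventually positive $C_0$-semigroup on $E$ with generator $A$. Then $s(A)=\omega_0(A)$, i.e. the spectral bound of $A$ equals the growth bound of the semigroup.
   Context: An AM-space is a Banach lattice $E$ such that $\|\sup\{f,g\}\| = \sup\{\|f\|,\|g\|\}$ for all $f,g\in E$ with $f \ge 0$ and $g\ge 0$. (If the Banach lattice is over the complex field, order relations refer to its real part, and the generator $A$ is not assumed to be real; if it is over the real field, the spectrum of an operator is understood via complexification.) For a $C_0$-semigroup on $E$ with generator $A$, the semigroup is denoted by $(e^{tA})_{t\ge 0}$. It is called individually eventually positive if for every $0 \le f\in E$ there exists $t_0\ge 0$ (which may depend on $f$) such that $e^{tA}f\ge 0$ for all $t\ge t_0$. The spectral bound is $s(A) := \sup\{\operatorname{Re}\lambda : \lambda \text{ is a spectral value of } A\} \in [-\infty,\infty)$, with $\sup\emptyset=-\infty$. The growth bound is $\omega_0(A) := \inf\{\omega\in\mathbb{R} : (e^{t(A-\omega)})_{t\geq 0} \text{ is bounded}\}\in[-\infty,\infty)$, where $e^{t(A-\omega)} = e^{-\omega t}e^{tA}$ and bounded means $\sup_{t\ge 0}\|e^{t(A-\omega)}\|<\infty$. *)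

(* Defs.v *)
From HB Require Import structures.
From mathcomp Require Import all_boot all_order all_algebra.
From mathcomp Require Import all_classical all_reals all_analysis.
From mathcomp Require Import complex ring lra.

Set Implicit Arguments.
Unset Strict Implicit.
Unset Printing Implicit Defensive.

Import Order.TTheory GRing.Theory Num.Theory.
Import numFieldNormedType.Exports.

Local Open Scope classical_set_scope.
Local Open Scope ring_scope.

(* The order is a mixin field because the hierarchy of library structures has
   no join between Order.Lattice and NormedModule and none can be added
   a posteriori. *)
HB.mixin Record isBanachLattice (R : realType) E & CompleteNormedModule R E := {
  vle : E -> E -> Prop;
  vsup : E -> E -> E;
  vle_refl : forall x, vle x x;
  vle_anti : forall x y, vle x y -> vle y x -> x = y;
  vle_trans : forall y x z, vle x y -> vle y z -> vle x z;
  vsup_le : forall x y z, vle (vsup x y) z <-> vle x z /\ vle y z;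
  vleD2r : forall x y z, vle x y -> vle (x + z) (y + z);
  vscaler_ge0 : forall (a : R) x, 0 <= a -> vle 0 x -> vle 0 (a *: x);
  vle_norm : forall x y, vle (vsup x (- x)) (vsup y (- y)) -> `|x| <= `|y|
}.

#[short(type="banachLatticeType")]
HB.structure Definition BanachLattice (R : realType) :=
  {E of isBanachLattice R E & CompleteNormedModule R E}.

Notation "x <=v y" := (vle x y) (at level 70, no associativity) : ring_scope.

(* This is also the AM-condition for the complexification of E, since the order
   lives on the real part and the norms agree there (complexified_norm_real). *)
Definition AM_space (R : realType) (E : banachLatticeType R) : Prop :=
  forall f g : E, 0 <=v f -> 0 <=v g ->
    `|vsup f g| = Num.max `|f| `|g|.

Section banach_lattice_theory.
Context {R : realType} {E : banachLatticeType R}.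
Implicit Types (x y z u : E) (a b c : R).

Definition vabs x : E := vsup x (- x).

Lemma vle_supl x y : x <=v vsup x y.
Proof. by have /vsup_le[] := vle_refl (vsup x y). Qed.

Lemma vle_supr x y : y <=v vsup x y.
Proof. by have /vsup_le[] := vle_refl (vsup x y). Qed.

Lemma vleD2l x y z : x <=v y -> z + x <=v z + y.
Proof. by rewrite ![z + _]addrC; exact: vleD2r. Qed.

Lemma vleD x y z u : x <=v y -> z <=v u -> x + z <=v y + u.
Proof. by move=> /(@vleD2r _ _ _ _ z) h /(vleD2l y); exact: vle_trans. Qed.

Lemma vsubr_ge0 x y : 0 <=v y - x <-> x <=v y.
Proof.
split=> [/(@vleD2r _ _ _ _ x)|/(@vleD2r _ _ _ _ (- x))].
  by rewrite add0r subrK.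
by rewrite subrr.
Qed.

Lemma vleN2 x y : x <=v y -> - y <=v - x.
Proof. by move=> /vsubr_ge0 h; apply/vsubr_ge0; rewrite opprK addrC. Qed.

Lemma vlerZ a x y : 0 <= a -> x <=v y -> a *: x <=v a *: y.
Proof.
move=> a0 /vsubr_ge0 h; apply/vsubr_ge0; rewrite -scalerBr.
exact: vscaler_ge0.
Qed.

Lemma vle_abs x : x <=v vabs x. Proof. exact: vle_supl. Qed.

Lemma vle_absN x : - x <=v vabs x. Proof. exact: vle_supr. Qed.

Lemma vhalf_ge0 x : 0 <=v x + x -> 0 <=v x.
Proof.
move=> /(@vscaler_ge0 _ _ 2^-1); rewrite invr_ge0 ler0n => /(_ isT).
by rewrite -mulr2n -[x *+ 2]scaler_nat scalerA mulVf ?scale1r// pnatr_eq0.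
Qed.

Lemma vabs_ge0 x : 0 <=v vabs x.
Proof.
by apply: vhalf_ge0; rewrite -[X in X <=v _](subrr x);
  exact: vleD (vle_abs x) (vle_absN x).
Qed.

Lemma vabs_le x y : x <=v y -> - x <=v y -> vabs x <=v y.
Proof. by move=> h1 h2; apply/vsup_le. Qed.

Lemma vabs_id x : 0 <=v x -> vabs x = x.
Proof.
move=> x0; apply: vle_anti; last exact: vle_abs.
apply: vabs_le; first exact: vle_refl.
by apply: vle_trans (x0); rewrite -oppr0; exact: vleN2.
Qed.

Lemma vabs_abs x : vabs (vabs x) = vabs x.
Proof. by rewrite vabs_id//; exact: vabs_ge0. Qed.

Lemma norm_vabs x : `|vabs x| = `|x|.
Proof.
apply/eqP; rewrite eq_le; apply/andP; split; apply: vle_norm;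
  rewrite -/(vabs _) -/(vabs _) vabs_abs; exact: vle_refl.
Qed.

Lemma vle_norm_abs x y : vabs x <=v y -> `|x| <= `|y|.
Proof. by move=> h; apply: vle_norm; apply: vle_trans h _; exact: vle_abs. Qed.

Lemma vle_norm_ge0 x y : 0 <=v x -> x <=v y -> `|x| <= `|y|.
Proof. by move=> x0 xy; apply: vle_norm_abs; rewrite vabs_id. Qed.

Lemma vleZ_abs a x : a *: x <=v `|a| *: vabs x.
Proof.
case: (ger0P a) => [a0|/ltW a0]; first by apply: vlerZ => //; exact: vle_abs.
rewrite -[a *: x]opprK -scaleNr -scalerN; apply: vlerZ; last exact: vle_absN.
by rewrite oppr_ge0.
Qed.

Lemma vpos_lipschitz x y : `|vsup x 0 - vsup y 0| <= `|x - y|.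
Proof.
rewrite -(norm_vabs (x - y)); apply: vle_norm_abs.
have h u v w : u <=v v + vabs w -> vsup u 0 <=v vsup v 0 + vabs w.
  move=> uvw; apply/vsup_le; split.
    by apply: vle_trans uvw _; apply: vleD2r; exact: vle_supl.
  rewrite -[X in X <=v _]addr0; apply: vleD; first exact: vle_supr.
  exact: vabs_ge0.
have subl u v w : u <=v v + w -> u - v <=v w.
  by move=> /(@vleD2r _ _ _ _ (- v)); rewrite addrAC subrr add0r.
apply: vabs_le; rewrite ?opprB; apply: subl; apply: h.
  by rewrite -[X in X <=v _](subrK y) addrC; apply: vleD2l; exact: vle_abs.
rewrite -[X in X <=v _](subrK x) addrC -opprB; apply: vleD2l.
exact: vle_absN.
Qed.

Lemma vge0_closed (s : nat -> E) x :
  s @ \oo --> x -> (forall n, 0 <=v s n) -> 0 <=v x.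
Proof.
move=> sx s0.
suff : vsup (- x) 0 = 0.
  by move=> h; rewrite -[x]opprK -oppr0; apply: vleN2; rewrite -h;
    exact: vle_supl.
apply/eqP; rewrite -normr_le0; apply/ler_addgt0Pr => e e0; rewrite add0r.
have /cvgrPdist_le/(_ _ e0)[N _ /(_ N (leqnn N)) /=] := sx.
apply: le_trans.
have -> : vsup (- x) 0 = vsup (- x) 0 - vsup (- s N) 0.
  suff -> : vsup (- s N) 0 = 0 by rewrite subr0.
  apply: vle_anti; last exact: vle_supr.
  apply/vsup_le; split; last exact: vle_refl.
  by rewrite -[X in _ <=v X]oppr0; apply: vleN2.
by apply: le_trans (vpos_lipschitz _ _) _; rewrite opprK addrC distrC.
Qed.

End banach_lattice_theory.

(* A complex Banach lattice is the complexification of a real one, its real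
   part, normed by z |-> `| |z| |. *)
Record complexified (E : Type) := VComplex { vRe : E; vIm : E }.
Arguments vRe {E}.
Arguments vIm {E}.

Section modulus.
Context {R : realType} {E : banachLatticeType R}.
Implicit Types (z w : complexified E) (p q : R * R) (m u : E).

Definition unit_circle : set (R * R) := [set p | p.1 ^+ 2 + p.2 ^+ 2 = 1].

Definition rotated_re z p : E := p.1 *: vRe z + p.2 *: vIm z.

(* The modulus is |z| = sup_theta Re (e^(- i theta) z), with (cos theta, sin theta) replaced
   by an arbitrary point of the unit circle. *)
Definition is_modulus z m : Prop :=
  (forall p, unit_circle p -> rotated_re z p <=v m) /\
  (forall u, (forall p, unit_circle p -> rotated_re z p <=v u) -> m <=v u).

Definition modulus z : E := xget 0 [set m | is_modulus z m].

Section modulus_exists.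
Variable z : complexified E.

Let cell n (i j : nat) : set (R * R) := [set p | [/\ unit_circle p,
  `|p.1 + 1 - i%:R / n.+1%:R| <= n.+1%:R^-1 &
  `|p.2 + 1 - j%:R / n.+1%:R| <= n.+1%:R^-1]].

Let net n i j : R * R := xget (1, 0) (cell n i j).

Let fsup (l : seq E) : E := foldr vsup (rotated_re z (1, 0)) l.

Let s n : E := fsup [seq rotated_re z (net n i j) |
  i <- iota 0 (2 * n.+1).+1, j <- iota 0 (2 * n.+1).+1].

Let c : E := vabs (vRe z) + vabs (vIm z).

Let c_ge0 : 0 <=v c.
Proof. by rewrite -[0]addr0; apply: vleD; exact: vabs_ge0. Qed.

Let fsup_ub l x : x \in l -> x <=v fsup l.
Proof.
elim: l => //= y l ih; rewrite inE => /predU1P[->|/ih h]; first exact: vle_supl.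
by apply: vle_trans h _; exact: vle_supr.
Qed.

Let fsup_le l u : rotated_re z (1, 0) <=v u ->
  (forall x, x \in l -> x <=v u) -> fsup l <=v u.
Proof.
move=> u0; elim: l => //= y l ih h; apply/vsup_le; split.
  by apply: h; rewrite inE eqxx.
by apply: ih => x xl; apply: h; rewrite inE xl orbT.
Qed.

Let circle10 : unit_circle (1, 0).
Proof. by rewrite /unit_circle/= expr1n expr0n addr0. Qed.

Let net_circle n i j : unit_circle (net n i j).
Proof. by rewrite /net; case: xgetP => [p _ []|]. Qed.

Let s_le n u : (forall p, unit_circle p -> rotated_re z p <=v u) -> s n <=v u.
Proof.
move=> h; apply: fsup_le; first exact: h.
by move=> x /allpairsP[[i j] [_ _ ->]]; exact: h.
Qed.

Let grid n (a : R) : -1 <= a <= 1 -> exists2 i : nat, (i <= 2 * n.+1)%N &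
  `|a + 1 - i%:R / n.+1%:R| <= n.+1%:R^-1.
Proof.
move=> /andP[a1 a2]; have n0 : 0 < n.+1%:R :> R by rewrite ltr0n.
have x0 : 0 <= (a + 1) * n.+1%:R by rewrite mulr_ge0// -lerBlDr sub0r.
have /andP[t1 t2] := truncn_itv x0.
exists (Num.truncn ((a + 1) * n.+1%:R)).
  rewrite -(ler_nat R); apply: le_trans t1 _; rewrite natrM ler_pM2r//.
  by rewrite -lerBrDr (le_trans a2)// -natr1 addrK.
rewrite -(ler_pM2r n0) mulVf ?gt_eqF// -[X in _ * X <= _](gtr0_norm n0) -normrM.
rewrite mulrBl divfK ?gt_eqF// ger0_norm ?subr_ge0//.
by rewrite lerBlDl natr1 ltW.
Qed.

Let circle_itv p : unit_circle p -> (-1 <= p.1 <= 1) /\ (-1 <= p.2 <= 1).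
Proof.
rewrite /unit_circle/= => h.
by split; rewrite -ler_norml -(@expr_le1 _ 2)// real_normK ?num_real// -h
  ?lerDl ?lerDr sqr_ge0.
Qed.

Let le_s n p : unit_circle p -> rotated_re z p <=v s n + (2 / n.+1%:R) *: c.
Proof.
move=> pc; have [/(grid n)[i i2 hi] /(grid n)[j j2 hj]] := circle_itv pc.
have [_ h1 h2] : cell n i j (net n i j).
  by rewrite /net; case: xgetP => [//|/(_ p)]; case.
have hs : rotated_re z (net n i j) <=v s n.
  by apply: fsup_ub; apply/allpairsP; exists (i, j); rewrite !mem_iota !add0n.
have -> : rotated_re z p = rotated_re z (net n i j) +
   ((p.1 - (net n i j).1) *: vRe z + (p.2 - (net n i j).2) *: vIm z).
  by rewrite /rotated_re !scalerBl addrACA ![_ + (_ - _)]addrC !subrK.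
apply: vleD => //; rewrite /c scalerDr.
have dist (a b d : R) : `|a + 1 - d| <= n.+1%:R^-1 -> `|b + 1 - d| <= n.+1%:R^-1 ->
    `|a - b| <= 2 / n.+1%:R.
  move=> ha hb; have -> : a - b = (a + 1 - d) - (b + 1 - d) by ring.
  by apply: le_trans (ler_normB _ _) _; rewrite mulr_natl mulr2n lerD.
have bnd (a : R) (x : E) : `|a| <= 2 / n.+1%:R -> a *: x <=v (2 / n.+1%:R) *: vabs x.
  move=> ha; apply: vle_trans (vleZ_abs _ _) _; apply/vsubr_ge0.
  by rewrite -scalerBl; apply: vscaler_ge0; [rewrite subr_ge0|exact: vabs_ge0].
by apply: vleD; apply: bnd; apply: dist; eassumption.
Qed.

Let e n : R := 2 / n.+1%:R * `|c|.

Let s_cauchy n k : `|s n - s k| <= e n + e k.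
Proof.
have e0 i : 0 <= 2 / i.+1%:R :> R by rewrite divr_ge0.
have -> : e n + e k = `|(2 / n.+1%:R + 2 / k.+1%:R) *: c|.
  by rewrite normrZ ger0_norm ?addr_ge0// mulrDl.
have key i j : s i - s j <=v (2 / j.+1%:R) *: c.
  rewrite -(addrK (s j) (_ *: c)); apply: vleD2r; rewrite addrC.
  by apply: s_le => p; exact: le_s.
apply: vle_norm_abs; apply: vabs_le; rewrite ?opprB scalerDl.
  rewrite -[X in X <=v _]add0r; apply: vleD => //.
  exact: vscaler_ge0.
rewrite -[X in X <=v _]addr0; apply: vleD => //.
exact: vscaler_ge0.
Qed.

Let e_cvg0 : e @ \oo --> (0 : R).
Proof.
rewrite -(mul0r `|c|); apply: cvgMr_tmp.
rewrite -(mulr0 2); apply: cvgMl_tmp.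
exact: cvg_harmonic.
Qed.

Let s_cvg : cvgn s.
Proof.
apply/cauchy_cvgP/cauchy_exP => d d0.
have d20 : 0 < d / 2 by rewrite divr_gt0.
have /cvgrPdist_lt/(_ _ d20)[N _ hN] := e_cvg0.
exists (s N); exists N => // k Nk; rewrite /= -ball_normE/=.
apply: le_lt_trans (s_cauchy _ _) _.
have h i : (N <= i)%N -> e i < d / 2.
  move=> /hN /=; rewrite sub0r normrN; apply: le_lt_trans; exact: ler_norm.
by rewrite [d]splitr ltrD// h.
Qed.

Lemma modulusP : is_modulus z (modulus z).
Proof.
apply: (@xgetPex _ 0 [set m | is_modulus z m]).
exists (lim (s @ \oo)); split=> [p pc|u hu]; apply/vsubr_ge0.
  apply: (@vge0_closed _ _ (fun n => s n + (2 / n.+1%:R) *: c - rotated_re z p)).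
    apply: cvgB; last exact: cvg_cst.
    rewrite -[X in _ --> X]addr0; apply: cvgD; first exact: s_cvg.
    rewrite -(scale0r c); apply: cvgZr_tmp.
    rewrite -(mulr0 2); apply: cvgMl_tmp.
    exact: cvg_harmonic.
  by move=> n; apply/vsubr_ge0; exact: le_s.
apply: (@vge0_closed _ _ (fun n => u - s n)).
  by apply: cvgB; [exact: cvg_cst|exact: s_cvg].
by move=> n; apply/vsubr_ge0; exact: s_le.
Qed.

End modulus_exists.

End modulus.

Section complexified_choice.
Variable E : Type.

Definition pair_of_complexified (z : complexified E) : E * E := (vRe z, vIm z).

Definition complexified_of_pair (p : E * E) : complexified E :=
  VComplex p.1 p.2.

Lemma pair_of_complexifiedK : cancel pair_of_complexified complexified_of_pair.
Proof. by case. Qed.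

End complexified_choice.

HB.instance Definition _ (E : choiceType) :=
  Choice.copy (complexified E) (can_type (@pair_of_complexifiedK E)).

Section complexified_lmodule.
Local Open Scope complex_scope.
Variables (R : realType) (E : lmodType R).
Implicit Types z w : complexified E.

Definition addv z w := VComplex (vRe z + vRe w) (vIm z + vIm w).

Definition oppv z := VComplex (- vRe z) (- vIm z).

Definition scalev (l : R[i]) z :=
  VComplex (complex.Re l *: vRe z - complex.Im l *: vIm z) (complex.Re l *: vIm z + complex.Im l *: vRe z).

Let addvA : associative addv.
Proof. by move=> [? ?] [? ?] [? ?]; congr VComplex; exact: addrA. Qed.

Let addvC : commutative addv.
Proof. by move=> [? ?] [? ?]; congr VComplex; exact: addrC. Qed.

Let add0v : left_id (VComplex 0 0) addv.
Proof. by move=> [? ?]; congr VComplex; exact: add0r. Qed.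

Let addNv : left_inverse (VComplex 0 0) oppv addv.
Proof. by move=> [? ?]; congr VComplex; exact: addNr. Qed.

HB.instance Definition _ :=
  GRing.isZmodule.Build (complexified E) addvA addvC add0v addNv.

Let scalevA a b z : scalev a (scalev b z) = scalev (a * b) z.
Proof.
case: a b z => [a a'] [b b'] [x y]; congr VComplex => /=;
  rewrite !(scalerBl, scalerDl, scalerBr, scalerDr, scalerA) ?opprD.
  by rewrite [X in _ + X = _]addrC addrACA.
by rewrite [X in _ + X = _]addrC addrACA.
Qed.

Let scale1v : left_id 1 scalev.
Proof.
by move=> [x y]; congr VComplex => /=; rewrite scale1r scale0r ?subr0 ?addr0.
Qed.

Let scalevDr : right_distributive scalev +%R.
Proof.
move=> a [x y] [x' y']; congr VComplex => /=; rewrite !scalerDr ?opprD;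
  exact: addrACA.
Qed.

Let scalevDl z : {morph scalev^~ z : a b / a + b}.
Proof.
move=> [a a'] [b b']; congr VComplex => /=; rewrite !scalerDl ?opprD;
  exact: addrACA.
Qed.

HB.instance Definition _ := GRing.Zmodule_isLmodule.Build R[i] (complexified E)
  scalevA scale1v scalevDr scalevDl.

Lemma vReD z w : vRe (z + w) = vRe z + vRe w. Proof. by []. Qed.
Lemma vImD z w : vIm (z + w) = vIm z + vIm w. Proof. by []. Qed.
Lemma vReN z : vRe (- z) = - vRe z. Proof. by []. Qed.
Lemma vImN z : vIm (- z) = - vIm z. Proof. by []. Qed.
Lemma vReZ (l : R[i]) z : vRe (l *: z) = complex.Re l *: vRe z - complex.Im l *: vIm z.
Proof. by []. Qed.
Lemma vImZ (l : R[i]) z : vIm (l *: z) = complex.Re l *: vIm z + complex.Im l *: vRe z.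
Proof. by []. Qed.

End complexified_lmodule.

Section complexified_norm.
Local Open Scope complex_scope.
Variables (R : realType) (E : banachLatticeType R).
Implicit Types z w : complexified E.

Lemma rotated_re_le z p : unit_circle p -> rotated_re z p <=v modulus z.
Proof. by have [h _] := modulusP z; exact: h. Qed.

Lemma modulus_le z u :
  (forall p, unit_circle p -> rotated_re z p <=v u) -> modulus z <=v u.
Proof. by have [_ h] := modulusP z; exact: h. Qed.

Lemma modulus_ge0 z : 0 <=v modulus z.
Proof.
apply: vhalf_ge0.
have -> : 0 = rotated_re z (1, 0) + rotated_re z (-1, 0).
  by rewrite /rotated_re/= !scale0r !addr0 scaleN1r scale1r subrr.
by apply: vleD; apply: rotated_re_le; rewrite /unit_circle/=; ring.
Qed.

Lemma vabs_Re_le z : vabs (vRe z) <=v modulus z.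
Proof.
apply: vabs_le.
  have -> : vRe z = rotated_re z (1, 0).
    by rewrite /rotated_re/= scale0r addr0 scale1r.
  by apply: rotated_re_le; rewrite /unit_circle/=; ring.
have -> : - vRe z = rotated_re z (-1, 0).
  by rewrite /rotated_re/= scale0r addr0 scaleN1r.
by apply: rotated_re_le; rewrite /unit_circle/=; ring.
Qed.

Lemma vabs_Im_le z : vabs (vIm z) <=v modulus z.
Proof.
apply: vabs_le.
  have -> : vIm z = rotated_re z (0, 1).
    by rewrite /rotated_re/= scale0r add0r scale1r.
  by apply: rotated_re_le; rewrite /unit_circle/=; ring.
have -> : - vIm z = rotated_re z (0, -1).
  by rewrite /rotated_re/= scale0r add0r scaleN1r.
by apply: rotated_re_le; rewrite /unit_circle/=; ring.
Qed.

Lemma unit_circle_le1 (p : R * R) : unit_circle p -> `|p.1| <= 1 /\ `|p.2| <= 1.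
Proof.
rewrite /unit_circle/= => h.
by split; rewrite -(@expr_le1 _ 2)// real_normK ?num_real// -h
  ?lerDl ?lerDr sqr_ge0.
Qed.

Lemma vleZ1 (a : R) (x : E) : `|a| <= 1 -> a *: x <=v vabs x.
Proof.
move=> a1; apply: vle_trans (vleZ_abs _ _) _; apply/vsubr_ge0.
rewrite -[X in X - _]scale1r -scalerBl; apply: vscaler_ge0; last exact: vabs_ge0.
by rewrite subr_ge0.
Qed.

Lemma modulus_le_abs z : modulus z <=v vabs (vRe z) + vabs (vIm z).
Proof.
by apply: modulus_le => p /unit_circle_le1[p1 p2]; apply: vleD; exact: vleZ1.
Qed.

Lemma modulus_real (x : E) : modulus (VComplex x 0) = vabs x.
Proof.
apply: vle_anti; last exact: (vabs_Re_le (VComplex x 0)).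
apply: vle_trans (modulus_le_abs _) _.
by rewrite /= (vabs_id (vle_refl 0)) addr0; exact: vle_refl.
Qed.

Definition normv z : R[i] := `|modulus z|%:C.

Let normvD z w : normv (z + w) <= normv z + normv w.
Proof.
rewrite /normv -rmorphD/= lecR; apply: le_trans (ler_normD _ _).
apply: vle_norm_ge0; first exact: modulus_ge0.
apply: modulus_le => p pc; rewrite /rotated_re vReD vImD !scalerDr addrACA.
by apply: vleD; exact: rotated_re_le.
Qed.

Let normc_ge0 (l : R[i]) : 0 <= Normc.normc l.
Proof. by case: l => a b; exact: sqrtr_ge0. Qed.

Let modulusZ_le (l : R[i]) z : modulus (l *: z) <=v Normc.normc l *: modulus z.
Proof.
have [->|l0] := eqVneq l 0.
  have -> : (0 : R[i]) *: z = VComplex 0 0 by rewrite scale0r.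
  rewrite modulus_real (vabs_id (vle_refl 0)) Normc.normc0 scale0r; exact: vle_refl.
have r0 : 0 < Normc.normc l.
  by rewrite lt_neqAle eq_sym normc_ge0 andbT; apply: contra_neq l0 => /Normc.eq0_normc.
have r2 : Normc.normc l ^+ 2 = complex.Re l ^+ 2 + complex.Im l ^+ 2.
  by case: l {l0 r0} => a b /=; rewrite sqr_sqrtr// addr_ge0// sqr_ge0.
move: (Normc.normc l) r0 r2 => r r0 r2.
apply: modulus_le => -[a b]; rewrite /unit_circle/= => ab.
pose u := a * complex.Re l + b * complex.Im l.
pose v := b * complex.Re l - a * complex.Im l.
have -> : rotated_re (l *: z) (a, b) = r *: rotated_re z (u / r, v / r).
  rewrite /rotated_re vReZ vImZ [RHS]scalerDr [(a, b).1]/= [(a, b).2]/=.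
  rewrite !(@scalerA _ _ r) ![r * _]mulrC !divfK ?gt_eqF// /u /v !(scalerBr, scalerDr, scalerDl, scalerBl, scalerA).
  by rewrite [X in _ + X = _]addrC addrACA [X in _ + X = _]addrC scaleNr.
apply: vlerZ; first exact: ltW.
apply: rotated_re_le; rewrite /unit_circle/= !expr_div_n -mulrDl.
have -> : u ^+ 2 + v ^+ 2 =
    (a ^+ 2 + b ^+ 2) * (complex.Re l ^+ 2 + complex.Im l ^+ 2).
  by rewrite /u /v; ring.
by rewrite ab mul1r -r2 divff// expf_neq0// gt_eqF.
Qed.

Let normcE (l : R[i]) : `|l| = (Normc.normc l)%:C. Proof. by []. Qed.

Let normvZ_le (l : R[i]) z : normv (l *: z) <= `|l| * normv z.
Proof.
rewrite normcE /normv -rmorphM/= lecR -[X in X * _]ger0_norm ?normc_ge0//.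
by rewrite -normrZ; apply: vle_norm_ge0; [exact: modulus_ge0|exact: modulusZ_le].
Qed.

Let normv_ge0 z : 0 <= normv z.
Proof. by rewrite /normv ler0c. Qed.

Let normvZ (l : R[i]) z : normv (l *: z) = `|l| * normv z.
Proof.
apply/eqP; rewrite eq_le normvZ_le/=.
have [->|l0] := eqVneq l 0; first by rewrite normr0 mul0r.
rewrite -[X in _ * normv X](scalerK l0) -ler_pdivlMl ?normr_gt0//.
by rewrite -normfV normvZ_le.
Qed.

Let normv0_eq0 z : normv z = 0 -> z = 0.
Proof.
move=> /complexI/normr0_eq0 m0.
have h x : vabs x <=v modulus z -> x = 0.
  by move=> /vle_norm_abs; rewrite m0 normr0 normr_le0 => /eqP.
have re0 := h _ (vabs_Re_le z); have im0 := h _ (vabs_Im_le z).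
by case: z re0 im0 {m0 h} => x y /= -> ->.
Qed.

HB.instance Definition _ := Lmodule_isNormed.Build R[i] (complexified E)
  normvD normvZ normv0_eq0.

Lemma complexified_normE z : `|z| = `|modulus z|%:C. Proof. by []. Qed.

Lemma complexified_norm_real (x : E) : `|VComplex x 0| = `|x|%:C.
Proof. by rewrite complexified_normE modulus_real norm_vabs. Qed.

Lemma norm_vRe_le z : `|vRe z|%:C <= `|z|.
Proof. by rewrite lecR; apply: vle_norm_abs; exact: vabs_Re_le. Qed.

Lemma norm_vIm_le z : `|vIm z|%:C <= `|z|.
Proof. by rewrite lecR; apply: vle_norm_abs; exact: vabs_Im_le. Qed.

Lemma complexified_norm_le z : `|z| <= (`|vRe z| + `|vIm z|)%:C.
Proof.
rewrite lecR -(norm_vabs (vRe z)) -(norm_vabs (vIm z)).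
apply: le_trans (ler_normD _ _).
by apply: vle_norm_ge0; [exact: modulus_ge0|exact: modulus_le_abs].
Qed.

Lemma complexified_complete (F : set_system (complexified E)) :
  ProperFilter F -> cauchy F -> cvg F.
Proof.
move=> FF /cauchyP Fc.
have proj (f : complexified E -> E) : (forall z w, f (z - w) = f z - f w) ->
    (forall z, `|f z|%:C <= `|z|) -> cvg (f @ F).
  move=> fB fle; apply/cauchy_cvgP/cauchy_exP => d d0.
  have d0' : 0 < d%:C by rewrite ltcR.
  have [z Fz] := Fc _ d0'; exists (f z).
  suff : F (f @^-1` ball (f z) d) by [].
  apply: filterS Fz => w.
  rewrite -!ball_normE /= => zw; rewrite -fB -ltcR.
  exact: le_lt_trans (fle _) zw.
have /cvg_ex[/= a Fa] : cvg (vRe @ F) by apply: proj => //; exact: norm_vRe_le.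
have /cvg_ex[/= b Fb] : cvg (vIm @ F) by apply: proj => //; exact: norm_vIm_le.
apply/cvg_ex; exists (VComplex a b); apply/cvgrPdist_lt => d.
rewrite ltcE /= => /andP[/eqP d_im d0].
have d2 : 0 < complex.Re d / 2 by rewrite divr_gt0.
have dE : d = (complex.Re d)%:C by case: d d_im {d0 d2} => ? ? /= ->.
move/cvgrPdist_lt : Fa => /(_ _ d2) Fa; move/cvgrPdist_lt : Fb => /(_ _ d2) Fb.
near=> z; rewrite dE; apply: le_lt_trans (complexified_norm_le _) _.
rewrite ltcR [complex.Re d]splitr ltrD//; near: z; [exact: Fa|exact: Fb].
Unshelve. all: by end_near. Qed.

HB.instance Definition _ :=
  Uniform_isComplete.Build (complexified E) complexified_complete.

End complexified_norm.

Section semigroups.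
(* iota is the embedding of the real numbers into the scalars: idfun for K = R,
   real_complex R for K = R[i]. *)
Context {R : realType} {K : numFieldType} (iota : {rmorphism R -> K}).
Context {E : completeNormedModType K}.

(* The values T t with t < 0 are irrelevant here and below. *)
Record C0_semigroup (T : R -> E -> E) : Prop := {
  C0_linear : forall t, 0 <= t -> linear (T t);
  C0_continuous : forall t, 0 <= t -> continuous (T t);
  C0_at0 : forall x, T 0 x = x;
  C0_add : forall s t x, 0 <= s -> 0 <= t -> T (s + t) x = T s (T t x);
  C0_strongly_continuous : forall x, T t x @[t --> 0^'+] --> x
}.

(* Unbounded operators, here and below, are given by their graphs. *)
Definition generator (T : R -> E -> E) : set (E * E) :=
  [set p | iota t^-1 *: (T t p.1 - p.1) @[t --> 0^'+] --> p.2].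

Definition rescaled (w : R) (T : R -> E -> E) : R -> E -> E :=
  fun t x => iota (expR (- w * t)) *: T t x.

Definition bounded_semigroup (T : R -> E -> E) : Prop :=
  exists M : R, forall t x, 0 <= t -> `|T t x| <= iota M * `|x|.

Definition growth_bound (T : R -> E -> E) : \bar R :=
  ereal_inf [set w%:E | w in [set w | bounded_semigroup (rescaled w T)]].

Definition individually_eventually_positive (cone : set E) (T : R -> E -> E) :
    Prop :=
  forall f, cone f -> exists2 t0, 0 <= t0 & forall t, t0 <= t -> cone (T t f).

End semigroups.

Section spectrum.
Context {R : realType} {E : completeNormedModType R[i]}.

(* l is in the resolvent set iff l - A : D(A) -> E is bijective with bounded
   inverse B. *)
Definition resolvent_set (A : set (E * E)) : set R[i] :=
  [set l | exists B : E -> E, [/\ linear B, continuous B &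
    forall x y, B y = x <-> exists2 Ax, A (x, Ax) & l *: x - Ax = y]].

Definition spectrum (A : set (E * E)) : set R[i] := ~` resolvent_set A.

Definition spectral_bound (A : set (E * E)) : \bar R :=
  ereal_sup [set (complex.Re l)%:E | l in spectrum A].

End spectrum.

Definition complexified_operator (E : Type) (A : set (E * E)) :
    set (complexified E * complexified E) :=
  [set p | A (vRe p.1, vRe p.2) /\ A (vIm p.1, vIm p.2)].

Definition positive_cone (R : realType) (E : banachLatticeType R) : set E :=
  [set f | 0 <=v f].
Arguments positive_cone {R} E.

Definition complexified_positive_cone (R : realType) (E : banachLatticeType R) :
    set (complexified E) :=
  [set f | 0 <=v vRe f /\ vIm f = 0].
Arguments complexified_positive_cone {R} E.

(* Main.v *)
From HB Require Import structures.
Require Import Defs.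
From mathcomp Require Import all_boot all_order all_algebra.
From mathcomp Require Import all_classical all_reals all_analysis.
From mathcomp Require Import complex ring lra.

Set Implicit Arguments.
Unset Strict Implicit.
Unset Printing Implicit Defensive.

Import Order.TTheory GRing.Theory Num.Theory.
Import numFieldNormedType.Exports.
Local Open Scope classical_set_scope.
Local Open Scope ring_scope.

(** The spectral bound is at most the growth bound for every C0-semigroup: if
    e^(-wt) T(t) is bounded and Re l > w, then S(t) = e^(-lt) T(t) decays
    exponentially, and the Riemann sums over dyadic grids of the integral of S
    over [0, oo[ converge to an inverse of l - A ([bounded_half_plane]).

    For the converse let w be a real number above the spectral bound, and
    rescale so that w = 0. It suffices that the semigroup S is bounded, knowing
    that the half line [0, oo[ lies in the resolvent set of its generator.

    If f >= 0, then some S(t0) f belongs to the closed cone Q of the vectors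
    with a positive orbit. Each resolvent at a large real number maps Q to Q,
    being a limit of sums of operators that do, and this property propagates
    down the half line to B = R(0, A) by the Neumann series
    ([resolvent0_preserves_cone]). Hence 0 <= S(t) B q <= B q for q in Q, the
    difference B q - S(t) B q being the integral of the positive function
    s |-> S(s) q over [0, t]. Every orbit of B is thus bounded, and by the
    uniform boundedness principle |S(t) B f| <= C |f| for all t >= 0
    ([orbit_resolvent_bounded]).

    The time after which S(t) f is positive depends on f, but a Baire argument
    in the positive cone gives n and u >= 0 such that S(t) (f + |f| u) >= 0 for
    all f >= 0 and t >= n ([uniformly_eventually_positive]).

    The AM-property enters as follows. Let f >= 0 and let K bound S on
    [n, t - n]. The curve r |-> S(r) f over [n, t - n] is dominated by one
    vector g of norm at most K |f| ([AM_curve_dominated]). With r = t - s,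
    the estimate S(t) f = S(s) S(r) f <= S(s) (g + 2K|f|u) holds for all s in
    [n, t - n]; integration over s bounds (t - 2n) S(t) f from above by
    S(n) y - S(t - n) y with y = B (g + 2K|f|u), whose norm is at most a
    constant times K |f|. The same upper bound for u in place of f gives a
    lower bound for S(t) f. For large t the factor t - 2n absorbs the
    constants, so a bound K for S on an initial interval persists forever
    ([eventually_positive_bounded]).

    All of this takes place in the complexification of E; a semigroup on E
    itself is handled by complexifying it. Integrals of orbits are replaced by
    finite sums throughout ([generator_telescope]). *)

(** * Bounded operators and Baire category *)

Section bounded_operators.
Context {R : realType}.

Lemma linear_continuous_bound (U W : normedModType R) (f : U -> W) :
  linear f -> continuous f -> exists2 M, 0 < M & forall x, `|f x| <= M * `|x|.
Proof.
move=> lf cf.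
pose g : {linear U -> W} := HB.pack f (GRing.isLinear.Build _ _ _ _ _ lf).
have /linear_bounded_continuous/linear_boundedP : continuous g by [].
by move=> /pinfty_ex_gt0[M M0 h]; exists M.
Qed.

Lemma linear_bound_continuous (U W : normedModType R) (f : U -> W) (M : R) :
  linear f -> (forall x, `|f x| <= M * `|x|) -> continuous f.
Proof.
move=> lf hM.
pose g : {linear U -> W} := HB.pack f (GRing.isLinear.Build _ _ _ _ _ lf).
suff : continuous g by [].
apply: bounded_linear_continuous; apply/linear_boundedP.
exists M; split; first exact: num_real.
move=> r Mr x; apply: le_trans (hM x) _.
by rewrite ler_wpM2r// ltW.
Qed.

Lemma uniform_boundedness (U : completeNormedModType R) (W : normedModType R)
    (I : Type) (D : set I) (f : I -> U -> W) :
  (forall i, D i -> linear (f i)) ->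
  (forall i, D i -> exists M, forall x, `|f i x| <= M * `|x|) ->
  (forall x, exists M, forall i, D i -> `|f i x| <= M) ->
  exists2 C, 0 < C & forall i, D i -> forall x, `|f i x| <= C * `|x|.
Proof.
move=> lf bf pf.
have := @Banach_Steinhauss R U W (f @` D) _ _ 1.
case.
- move=> _ [i Di <-]; split; last exact: lf.
  move=> r; have [M hM] := bf i Di; exists (`|M| * `|r|) => x xr.
  apply: le_trans (hM x) _; apply: le_trans (_ : `|M| * `|x| <= _).
    by rewrite ler_wpM2r// ler_norm.
  by rewrite ler_wpM2l// (le_trans xr)// ler_norm.
- move=> x; have [M hM] := pf x; exists M => _ [i Di <-]; exact: hM.
move=> C hC; exists (`|C| + 1) => [|i Di x]; first by rewrite ltr_pwDr.
have [->|x0] := eqVneq x 0.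
  have [M hM] := bf i Di; have := hM 0; rewrite normr0 mulr0 => h.
  by rewrite mulr0.
have nx : 0 < `|x| by rewrite normr_gt0.
have /(_ (`|x|^-1 *: x)) := hC (f i) (ex_intro2 _ _ i Di erefl).
rewrite normrZ normfV normr_id mulVf ?gt_eqF// => /(_ (lexx _)).
have -> : f i (`|x|^-1 *: x) = `|x|^-1 *: f i x.
  have h0 : f i 0 = 0.
    by have [M /(_ 0)] := bf i Di; rewrite normr0 mulr0 normr_le0 => /eqP.
  by have := lf i Di `|x|^-1 x 0; rewrite h0 !addr0.
rewrite normrZ normfV normr_id ler_pdivrMl// mulrC => h.
apply: le_trans h _; rewrite ler_wpM2r//.
by rewrite (le_trans (ler_norm _))// lerDl.
Qed.

End bounded_operators.

Section closed_baire.
Context {R : realType} {F : completeNormedModType R}.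

(** The usual nested balls construction, carried out inside P; the Baire theorem
    for the whole space does not apply because P may have empty interior. *)
Lemma closed_baire (P : set F) (Q : nat -> set F) :
  closed P -> P !=set0 -> (forall n, closed (Q n)) ->
  P `<=` \bigcup_n Q n ->
  exists n x e, [/\ P x, 0 < e & forall y, P y -> `|x - y| < e -> Q n y].
Proof.
move=> Pc [x0 Px0] Qc PQ; apply: contrapT => H.
have step n (p : F * R) : exists q : F * R, P p.1 -> 0 < p.2 ->
    [/\ P q.1, 0 < q.2, q.2 <= p.2 / 2, `|p.1 - q.1| <= p.2 / 2 &
       forall y, `|q.1 - y| <= q.2 -> ~ Q n y].
  have [[Pp p0]|h] := pselect (P p.1 /\ 0 < p.2); last first.
    by exists p => Pp p0; exfalso; apply: h.
  have p20 : 0 < p.2 / 2 by rewrite divr_gt0.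
  have [y [Py py nQ]] : exists y, [/\ P y, `|p.1 - y| < p.2 / 2 & ~ Q n y].
    apply: contrapT => h; apply: H; exists n, p.1, (p.2 / 2); split => // y Py py.
    by apply: contrapT => nQ; apply: h; exists y.
  have : nbhs y (~` Q n).
    by apply: open_nbhs_nbhs; split => //; exact: closed_openC.
  move=> /nbhs_ballP[e /= e0 he].
  (* Half of e, so that the closed ball around y still avoids Q n. *)
  exists (y, Num.min (e / 2) (p.2 / 2)) => _ _; split => //=.
  - by rewrite lt_min p20 divr_gt0.
  - by rewrite ge_min lexx orbT.
  - exact: ltW.
  - move=> z yz; apply: he; rewrite -ball_normE /=.
    apply: le_lt_trans yz _; rewrite gt_min.
    by apply/orP; left; rewrite ltr_pdivrMr// ltr_pMr// ltr1n.
have [g hg] := choice (fun np : nat * (F * R) => step np.1 np.2).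
pose s := fix s n := if n is m.+1 then g (m, s m) else (x0, 1 : R).
have sP n : P (s n).1 /\ 0 < (s n).2.
  elim: n => [|n [ih1 ih2]] /=; first by split=> //; rewrite ltr01.
  by have [] := hg (n, s n) ih1 ih2.
have sS n : [/\ (s n.+1).2 <= (s n).2 / 2, `|(s n).1 - (s n.+1).1| <= (s n).2 / 2 &
       forall y, `|(s n.+1).1 - y| <= (s n.+1).2 -> ~ Q n y].
  by have [h1 h2] := sP n; have [] := hg (n, s n) h1 h2.
have sD n k : `|(s n).1 - (s (n + k)%N).1| <= (s n).2 - (s (n + k)%N).2.
  elim: k => [|k ih]; first by rewrite addn0 !subrr normr0.
  rewrite addnS; have [h1 h2 _] := sS (n + k)%N.
  rewrite (le_trans (ler_distD (s (n + k)%N).1 _ _))//.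
  rewrite (le_trans (lerD ih h2))//.
  by lra.
have s2 n : (s n).2 <= (2 ^+ n)^-1.
  elim: n => [|n ih]; first by rewrite /= expr0 invr1.
  have [h1 _ _] := sS n; apply: le_trans h1 _.
  by rewrite exprSr invfM ler_wpM2r.
have s_cvg : cvgn (fun n => (s n).1).
  apply/cauchy_cvgP/cauchy_exP => d d0.
  have [N hN] : exists N, (s N).2 < d.
    have := @cvg_expr R 2^-1 _; rewrite ger0_norm// invf_lt1 ?ltr1n// => /(_ isT).
    move=> /cvgrPdist_lt/(_ d d0)[N _ /(_ N (leqnn N))] /=.
    rewrite sub0r normrN ger0_norm ?exprn_ge0// => h.
    by exists N; apply: le_lt_trans h; rewrite exprVn.
  exists (s N).1; exists N => // k Nk; rewrite /= -ball_normE/=.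
  rewrite -(subnKC Nk); apply: le_lt_trans (sD _ _) _.
  by apply: le_lt_trans hN; rewrite gerBl ltW//; case: (sP (N + (k - N))%N).
have hlim n : `|(s n).1 - lim ((fun n => (s n).1) @ \oo)| <= (s n).2.
  have /cvgrPdist_le h := s_cvg.
  apply/ler_addgt0Pr => d d0.
  have [N _ hN] := h d d0.
  have := hN (n + N)%N (leq_addl _ _) => /= h1.
  apply: le_trans (ler_distD (s (n + N)%N).1 _ _) _; apply: lerD.
    by apply: le_trans (sD _ _) _; rewrite gerBl ltW//; case: (sP (n + N)%N).
  by rewrite distrC.
have Pl : P (lim ((fun n => (s n).1) @ \oo)).
  apply: (@closed_cvg _ _ \oo _ (fun n => (s n).1) P Pc _ _ s_cvg).
  by apply: nearW => n; case: (sP n).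
have [n _ Qn] := PQ _ Pl.
by have [_ _ /(_ _ (hlim n.+1))] := sS n.
Qed.

End closed_baire.

(** * Elementary theory of C0-semigroups *)

Section right_limits.
Context {R : realType} {V : normedModType R}.

Lemma cvg_right0P (f : R -> V) (l : V) :
  f t @[t --> 0^'+] --> l <->
  forall e, 0 < e -> exists2 d, 0 < d & forall t, 0 < t <= d -> `|l - f t| <= e.
Proof.
split=> [/cvgrPdist_le fl e /fl|h].
  move=> [d /= d0 hd]; exists (d / 2); first by rewrite divr_gt0.
  move=> t /andP[t0 td]; apply: hd => //=.
  rewrite sub0r normrN gtr0_norm//; apply: le_lt_trans td _.
  by rewrite ltr_pdivrMr// ltr_pMr// ltr1n.
apply/cvgrPdist_le => e /h[d d0 hd]; exists d => //= t.
rewrite /= sub0r normrN => td t0; apply: hd; rewrite t0/=.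
by rewrite ltW//; apply: le_lt_trans td; exact: ler_norm.
Qed.

End right_limits.

Section semigroup.
Context {R : realType} {F : completeNormedModType R} {T : R -> F -> F}.
Hypothesis HT : C0_semigroup T.
Implicit Types (s t : R) (x y z : F).

Lemma C0_opD t x y : 0 <= t -> T t (x + y) = T t x + T t y.
Proof. by move=> t0; have := C0_linear HT t0 1 x y; rewrite !scale1r. Qed.

Lemma C0_op0 t : 0 <= t -> T t 0 = 0.
Proof. by move=> t0; apply: (addrI (T t 0)); rewrite -C0_opD// !addr0. Qed.

Lemma C0_opZ t a x : 0 <= t -> T t (a *: x) = a *: T t x.
Proof. by move=> t0; have := C0_linear HT t0 a x 0; rewrite C0_op0// !addr0. Qed.

Lemma C0_opB t x y : 0 <= t -> T t (x - y) = T t x - T t y.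
Proof. by move=> t0; rewrite C0_opD// -scaleN1r C0_opZ// scaleN1r. Qed.

Lemma C0_op_sum t n (f : nat -> F) : 0 <= t ->
  T t (\sum_(k < n) f k) = \sum_(k < n) T t (f k).
Proof.
move=> t0; apply: (big_morph (T t)); last exact: C0_op0.
by move=> x y; exact: C0_opD.
Qed.

Lemma C0_opC s t x : 0 <= s -> 0 <= t -> T s (T t x) = T t (T s x).
Proof. by move=> s0 t0; rewrite -!(C0_add HT)// addrC. Qed.

Lemma C0_near0 x e : 0 < e ->
  exists2 d, 0 < d & forall t, 0 <= t <= d -> `|T t x - x| <= e.
Proof.
move=> e0; have /cvg_right0P/(_ e e0)[d d0 hd] := C0_strongly_continuous HT (x := x).
exists d => // t /andP[]; rewrite le_eqVlt => /predU1P[<- _|t0 td].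
  by rewrite (C0_at0 HT) subrr normr0 ltW.
by rewrite distrC hd// t0.
Qed.

(** Otherwise there are t_n -> 0 with |T(t_n)| > n, although T(t_n) x -> x for
    each x: this contradicts uniform boundedness. *)
Lemma C0_bounded_near0 :
  exists2 d, 0 < d & exists M, forall t x, 0 <= t <= d -> `|T t x| <= M * `|x|.
Proof.
apply: contrapT => H.
have step n : exists p : R * F, 0 <= p.1 <= n.+1%:R^-1 /\ n%:R * `|p.2| < `|T p.1 p.2|.
  apply: contrapT => h; apply: H; exists n.+1%:R^-1; first by rewrite invr_gt0.
  exists n%:R => t x tn; rewrite leNgt; apply/negP => hx; apply: h.
  by exists (t, x).
have [g hg] := choice step.
have g0 n : 0 <= (g n).1 by have [/andP[]] := hg n.
have [C C0 hC] : exists2 C, 0 < C & forall n : nat, setT n -> forall x,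
    `|T (g n).1 x| <= C * `|x|.
  apply: uniform_boundedness.
  - by move=> n _; exact: C0_linear (g0 n).
  - move=> n _; have [M _ hM] := linear_continuous_bound (C0_linear HT (g0 n))
      (C0_continuous HT (g0 n)); by exists M.
  - move=> x; have [d d0 hd] := C0_near0 x ltr01.
    have [N hN] : exists N : nat, d^-1 < N.+1%:R.
      by exists (Num.truncn d^-1); exact: truncnS_gt.
    exists (`|x| + 1 + \sum_(n < N) `|T (g n).1 x|) => n _.
    have [nN|Nn] := ltnP n N.
      apply: le_trans (_ : \sum_(n < N) `|T (g n).1 x| <= _).
        by rewrite (bigD1 (Ordinal nN))//= lerDl sumr_ge0.
      by rewrite lerDr addr_ge0.
    apply: le_trans (_ : `|x| + 1 <= _); last by rewrite lerDl sumr_ge0.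
    rewrite -[T _ x](subrK x) addrC; apply: le_trans (ler_normD _ _) _.
    rewrite lerD2l; apply: hd.
    have [/andP[-> h] _] := hg n; apply: le_trans h _ => /=.
    rewrite -[leRHS]invrK lef_pV2 ?posrE ?invr_gt0//.
    by apply: ltW; apply: lt_le_trans hN _; rewrite ler_nat.
have [_] := hg (Num.truncn C).+1.
apply/negP; rewrite -leNgt; apply: le_trans (hC _ I _) _; rewrite ler_wpM2r//.
by rewrite ltW// truncnS_gt.
Qed.

Lemma C0_locally_bounded a :
  exists2 M, 1 <= M & forall t x, 0 <= t <= a -> `|T t x| <= M * `|x|.
Proof.
have [d d0 [M0 hM0]] := C0_bounded_near0.
pose M := `|M0| + 1.
have M1 : 1 <= M by rewrite lerDr.
have hM t x : 0 <= t <= d -> `|T t x| <= M * `|x|.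
  move=> td; apply: le_trans (hM0 _ _ td) _; rewrite ler_wpM2r//.
  by rewrite (le_trans (ler_norm _))// lerDl.
have key n : forall t x, 0 <= t <= n%:R * d -> `|T t x| <= M ^+ n * `|x|.
  elim: n => [|n ih] t x.
    rewrite mul0r -eq_le => /eqP <-.
    by rewrite (C0_at0 HT) expr0 mul1r.
  move=> /andP[t0 tn]; have [td|/ltW dt] := leP t d.
    apply: le_trans (hM _ _ _) _; first by rewrite t0.
    by rewrite ler_wpM2r// ler_eXnr.
  have td0 : 0 <= t - d by rewrite subr_ge0.
  have -> : T t x = T d (T (t - d) x).
    by rewrite -(C0_add HT) ?(ltW d0)// addrC subrK.
  apply: le_trans (hM _ _ _) _; first by rewrite lexx ltW.
  rewrite exprS -mulrA ler_wpM2l ?(le_trans ler01)//.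
  apply: ih; rewrite td0/= lerBlDr.
  by rewrite -[X in _ + X]mul1r -mulrDl natr1.
pose n := (Num.truncn (`|a| / d)).+1.
exists (M ^+ n); first exact: exprn_ege1.
move=> t x /andP[t0 ta]; apply: key; rewrite t0/=.
apply: le_trans ta _; apply: le_trans (ler_norm _) _.
by rewrite -ler_pdivrMr// ltW// truncnS_gt.
Qed.

Lemma C0_exponential_bound :
  exists M a, forall t x, 0 <= t -> `|T t x| <= M * expR (a * t) * `|x|.
Proof.
have [M M1 hM] := C0_locally_bounded 1.
have M0 : 0 < M by apply: lt_le_trans M1.
have key n : forall t x, 0 <= t <= n.+1%:R -> `|T t x| <= M ^+ n.+1 * `|x|.
  elim: n => [|n ih] t x; first by move=> /hM; rewrite expr1; exact.
  move=> /andP[t0 tn]; have [td|/ltW dt] := leP t 1.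
    apply: le_trans (hM _ _ _) _; first by rewrite t0.
    by rewrite ler_wpM2r// ler_eXnr.
  have td0 : 0 <= t - 1 by rewrite subr_ge0.
  have -> : T t x = T 1 (T (t - 1) x).
    by rewrite -(C0_add HT)// addrC subrK.
  apply: le_trans (hM _ _ _) _; first by rewrite lexx ler01.
  rewrite exprS -mulrA ler_wpM2l ?(le_trans ler01)//.
  by apply: ih; rewrite td0/= lerBlDr natr1.
exists M, (ln M) => t x t0.
have /andP[h1 h2] := truncn_itv t0.
apply: le_trans (key (Num.truncn t) _ _ _) _; first by rewrite t0 ltW.
rewrite ler_wpM2r// exprS ler_wpM2l ?(ltW M0)//.
have -> : M ^+ Num.truncn t = expR (ln M * (Num.truncn t)%:R).
  by rewrite expRM_natr lnK ?posrE.
rewrite ler_expR.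
by rewrite ler_wpM2l// ln_ge0.
Qed.

Lemma C0_uniformly_continuous a x e : 0 < e -> exists2 d, 0 < d &
  forall s t, 0 <= s <= a -> 0 <= t <= a -> `|s - t| <= d -> `|T s x - T t x| <= e.
Proof.
move=> e0; have [M M1 hM] := C0_locally_bounded a.
have M0 : 0 < M by apply: lt_le_trans M1.
have [d d0 hd] := C0_near0 x (divr_gt0 e0 M0).
exists d => //.
have key s t : 0 <= s -> s <= t -> t <= a -> t - s <= d -> `|T s x - T t x| <= e.
  move=> s0 st ta tsd.
  have ts0 : 0 <= t - s by rewrite subr_ge0.
  have -> : T t x = T s (T (t - s) x) by rewrite -(C0_add HT)// addrC subrK.
  rewrite -C0_opB//; apply: le_trans (hM _ _ _) _.
    by rewrite s0 (le_trans st).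
  rewrite mulrC -ler_pdivlMr// distrC; apply: hd.
  by rewrite ts0.
move=> s t /andP[s0 sa] /andP[t0 ta].
have [st|/ltW ts] := leP s t.
  by rewrite distrC ger0_norm ?subr_ge0//; exact: key.
by rewrite ger0_norm ?subr_ge0// => h; rewrite distrC; exact: key.
Qed.

Lemma generator_orbit t x y : 0 <= t ->
  generator idfun T (x, y) -> generator idfun T (T t x, T t y).
Proof.
move=> t0; rewrite /generator/= => h.
have := cvg_comp _ _ h (C0_continuous HT t0 (x := y)).
apply: cvg_trans; apply: near_eq_cvg; near=> s => /=.
have s0 : 0 <= s by [].
by rewrite C0_opZ// C0_opB// C0_opC.
Unshelve. all: by end_near. Qed.

Record closed_cone (C : set F) : Prop := {
  ccone_closed : closed C;
  ccone0 : C 0;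
  cconeD : forall x y, C x -> C y -> C (x + y);
  cconeZ : forall (a : R) x, 0 <= a -> C x -> C (a *: x)
}.

Lemma ccone_sum C n (f : nat -> F) : closed_cone C ->
  (forall k, (k < n)%N -> C (f k)) -> C (\sum_(k < n) f k).
Proof.
move=> HC hf; apply: (big_ind C); [exact: ccone0|exact: cconeD|].
by move=> k _; exact: hf.
Qed.

Lemma closed_approx (C : set F) x : closed C ->
  (forall e, 0 < e -> exists2 z, C z & `|x - z| <= e) -> C x.
Proof.
move=> Cc h; apply: Cc => B /nbhs_ballP[e /= e0 he].
have e2 : 0 < e / 2 by rewrite divr_gt0.
have [z Cz xz] := h (e / 2) e2.
exists z; split => //; apply: he; rewrite -ball_normE /=.
by apply: le_lt_trans xz _; rewrite ltr_pdivrMr// ltr_pMr// ltr1n.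
Qed.

(** The integral of T(s) a over [p, q] is T(p) y - T(q) y when A y = - a, and C
    is stable under integration. Writing h = (q - p) / m, the sum of
    T(p + kh) (y - T(h) y) over k < m telescopes to the integral, while
    (y - T(h) y) / h -> a; so it is close to the sum of h T(p + kh) a. *)
Lemma generator_telescope C p q y a b : closed_cone C -> 0 <= p -> p <= q ->
  generator idfun T (y, - a) -> (forall s, p <= s <= q -> C (T s a - b)) ->
  C (T p y - T q y - (q - p) *: b).
Proof.
move=> HC p0; rewrite le_eqVlt => /predU1P[<- _ _|pq gy hC].
  by rewrite !subrr scale0r subr0; exact: ccone0.
have L0 : 0 < q - p by rewrite subr_gt0.
have [M M1 hM] := C0_locally_bounded q.
have M0 : 0 < M by apply: lt_le_trans M1.
apply: closed_approx (ccone_closed HC) _ => e e0.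
have LM0 : 0 < (q - p) * M by rewrite mulr_gt0.
have /cvg_right0P/(_ _ (divr_gt0 e0 LM0))[d d0 hd] := gy.
(* The mesh h of the subdivision is at most d. *)
pose n := Num.truncn ((q - p) / d); pose h := (q - p) / n.+1%:R.
have h0 : 0 < h by rewrite divr_gt0.
have hdd : h <= d.
  by rewrite ler_pdivrMr// mulrC -ler_pdivrMr// ltW// truncnS_gt.
have nh : n.+1%:R * h = q - p by rewrite mulrC divfK.
have ps k : (k <= n.+1)%N -> 0 <= p + k%:R * h <= q /\ p <= p + k%:R * h <= q.
  move=> kn; have k0 : 0 <= k%:R * h by rewrite mulr_ge0// ltW.
  rewrite addr_ge0// lerDl k0/= -lerBrDl -nh ler_pM2r// ler_nat kn; by split.
exists (\sum_(k < n.+1) h *: (T (p + k%:R * h) a - b)).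
  apply: (ccone_sum (f := fun k => h *: (T (p + k%:R * h) a - b)) HC) => k kn; apply: (cconeZ HC) => //; first exact: ltW.
  by apply: hC; have [] := ps k (ltnW kn).
have -> : T p y - T q y = \sum_(k < n.+1) T (p + k%:R * h) (y - T h y).
  have -> : q = p + n.+1%:R * h by rewrite nh addrC subrK.
  have := telescope_sumr (fun k => T (p + k%:R * h) y) (leq0n n.+1).
  rewrite mul0r addr0 => hs; rewrite -opprB -hs.
  rewrite -sumrN big_mkord; apply: eq_bigr => k _; rewrite opprB.
  have pk : 0 <= p + k%:R * h.
    by rewrite addr_ge0// mulr_ge0// ltW.
  rewrite C0_opB// -(C0_add HT)//; last exact: ltW.
  by rewrite -addrA -natr1 mulrDl mul1r.
have -> : (q - p) *: b = \sum_(k < n.+1) h *: b.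
  by rewrite sumr_const card_ord -scaler_nat scalerA nh.
rewrite -!sumrB; apply: le_trans (ler_norm_sum _ _ _) _.
apply: le_trans (_ : \sum_(k < n.+1) h * (M * (e / ((q - p) * M))) <= _); last first.
  rewrite sumr_const card_ord -mulr_natl mulrA nh.
  have -> : (q - p) * (M * (e / ((q - p) * M))) = e.
    by field; rewrite !gt_eqF.
  exact: lexx.
apply: ler_sum => k _.
have [pk1 pk2] := ps k (ltnW (ltn_ord k)).
have pk : 0 <= p + k%:R * h by case/andP : pk1.
have -> : T (p + k%:R * h) (y - T h y) - h *: b - h *: (T (p + k%:R * h) a - b)
    = h *: T (p + k%:R * h) (- a - h^-1 *: (T h y - y)).
  rewrite -[- a]scaleN1r !(C0_opB, C0_opZ)// scaleN1r.
  rewrite !scalerBr scalerN !scalerA divff ?gt_eqF// !scale1r !opprB addrA subrK.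
  by rewrite addrC.
rewrite normrZ gtr0_norm// ler_wpM2l ?(ltW h0)//.
apply: le_trans (hM _ _ pk1) _; rewrite ler_wpM2l ?(ltW M0)//.
by apply: hd; rewrite h0.
Qed.

End semigroup.

(** * The resolvent of an exponentially decaying semigroup *)

Lemma dyadic_le {R : realType} (d : R) : 0 < d ->
  exists N, forall n, (N <= n)%N -> (2 ^+ n)^-1 <= d.
Proof.
move=> d0; exists (Num.truncn d^-1).+1 => n Nn.
rewrite -[leRHS]invrK lef_pV2 ?posrE ?invr_gt0 ?exprn_gt0//.
apply: ltW; apply: lt_le_trans (truncnS_gt _) _.
have -> : 2 ^+ n = (2 ^ n)%:R :> R by rewrite natrX.
rewrite ler_nat; apply: leq_trans Nn _; exact/ltnW/ltn_expl.
Qed.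

Section decaying_semigroup.
Context {R : realType} {F : completeNormedModType R} {T : R -> F -> F}.
Hypothesis HT : C0_semigroup T.
Variables (M delta : R).
Hypotheses (M0 : 0 <= M) (delta0 : 0 < delta).
Hypothesis T_decay :
  forall t x, 0 <= t -> `|T t x| <= M * expR (- (delta * t)) * `|x|.
Implicit Types (h s t : R) (x y z : F) (n N : nat).

(** The Riemann sum of step h for the integral of s |-> T(s) x over [0, Nh]. *)
Definition orbit_sum h N x : F := h *: \sum_(k < N) T (k%:R * h) x.

Let natM0 h k : 0 < h -> 0 <= k%:R * h.
Proof. by move=> h0; rewrite mulr_ge0// ltW. Qed.

Lemma orbit_sumB h N x y : 0 < h ->
  orbit_sum h N (x - y) = orbit_sum h N x - orbit_sum h N y.
Proof.
move=> h0; rewrite /orbit_sum -scalerBr -sumrB; congr (_ *: _).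
by apply: eq_bigr => k _; rewrite (C0_opB HT)// natM0.
Qed.

Lemma orbit_sumZ h N a x : 0 < h ->
  orbit_sum h N (a *: x) = a *: orbit_sum h N x.
Proof.
move=> h0; rewrite /orbit_sum [RHS]scalerA [a * h]mulrC -scalerA; congr (_ *: _).
rewrite scaler_sumr.
by apply: eq_bigr => k _; rewrite (C0_opZ HT)// natM0.
Qed.

Lemma orbit_sumD h N x y : 0 < h ->
  orbit_sum h N (x + y) = orbit_sum h N x + orbit_sum h N y.
Proof.
by move=> h0; rewrite -{1}[y]opprK orbit_sumB// -[- y]scaleN1r orbit_sumZ// scaleN1r opprK.
Qed.

Lemma orbit_sum_cat h a b x : 0 < h ->
  orbit_sum h (a + b) x = orbit_sum h a x + T (a%:R * h) (orbit_sum h b x).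
Proof.
move=> h0; rewrite /orbit_sum (C0_opZ HT) ?natM0// -scalerDr; congr (_ *: _).
rewrite big_split_ord /=; congr (_ + _).
rewrite (C0_op_sum HT b (fun k => T (k%:R * h) x)) ?natM0//.
apply: eq_bigr => k _.
by rewrite -(C0_add HT) ?natM0// -mulrDl natrD.
Qed.

Lemma orbit_sum_op h N t x : 0 < h -> 0 <= t ->
  T t (orbit_sum h N x) = orbit_sum h N (T t x).
Proof.
move=> h0 t0; rewrite /orbit_sum (C0_opZ HT)//; congr (_ *: _).
rewrite (C0_op_sum HT N (fun k => T (k%:R * h) x))//.
by apply: eq_bigr => k _; rewrite (C0_opC HT)// natM0.
Qed.

Lemma orbit_sum_shift h j N x : 0 < h ->
  T (j%:R * h) (orbit_sum h N x) - orbit_sum h N x =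
  orbit_sum h j (T (N%:R * h) x) - orbit_sum h j x.
Proof.
move=> h0; rewrite -[in RHS]orbit_sum_op ?natM0//.
have := orbit_sum_cat j N x h0; rewrite addnC orbit_sum_cat// => e.
apply/eqP; rewrite subr_eq addrAC eq_sym subr_eq; apply/eqP.
by rewrite addrC e addrC.
Qed.

Lemma orbit_sum1 h x : orbit_sum h 1 x = h *: x.
Proof. by rewrite /orbit_sum big_ord1 mul0r (C0_at0 HT). Qed.

(** Passing to the step h / m amounts to averaging x over [0, h] first, so that
    refinements of the grid can be compared through |T(s) x - x| for small s. *)
Lemma orbit_sum_refine h m N x : 0 < h -> (0 < m)%N ->
  orbit_sum (h / m%:R) (N * m) x =
  orbit_sum h N (h^-1 *: orbit_sum (h / m%:R) m x).
Proof.
move=> h0 m0; have h'0 : 0 < h / m%:R by rewrite divr_gt0// ltr0n.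
elim: N => [|N ih]; first by rewrite mul0n /orbit_sum !big_ord0 !scaler0.
rewrite mulSn orbit_sum_cat// ih -[N.+1]add1n orbit_sum_cat// orbit_sum1.
rewrite (scalerA h h^-1) divff ?gt_eqF// scale1r mul1r; congr (_ + T _ _).
by rewrite mulrC divfK// pnatr_eq0 -lt0n.
Qed.

Let C := M * ((1 + delta) / delta).

Let C0 : 0 <= C.
Proof. by rewrite mulr_ge0// divr_ge0// ?addr_ge0// ltW. Qed.

(** Geometric series: with q = e^(- delta h), the inequality
    h / (1 - q) <= (1 + delta h) / delta is 1 + delta h <= e^(delta h). *)
Lemma orbit_sum_bound h N x : 0 < h -> h <= 1 -> `|orbit_sum h N x| <= C * `|x|.
Proof.
move=> h0 h1; rewrite /orbit_sum normrZ gtr0_norm//.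
pose q := expR (- (delta * h)).
have dh : 0 < delta * h by rewrite mulr_gt0.
have q0 : 0 < q by exact: expR_gt0.
have q1 : q * (1 + delta * h) <= 1.
  apply: le_trans (_ : q * expR (delta * h) <= _).
    by rewrite ler_wpM2l ?(ltW q0)// expR_ge1Dx.
  by rewrite -expRD addNr expR0.
have qlt1 : q < 1.
  by rewrite /q -expR0 ltr_expR oppr_lt0.
have hk (k : nat) : `|T (k%:R * h) x| <= M * `|x| * q ^+ k.
  apply: le_trans (T_decay _ _) _; first exact: natM0.
  rewrite mulrAC ler_wpM2l ?mulr_ge0//.
  by rewrite /q -expRM_natl mulrN mulrCA.
apply: le_trans (_ : h * \sum_(k < N) (M * `|x|) * q ^+ k <= _).
  rewrite ler_wpM2l ?(ltW h0)//; apply: le_trans (ler_norm_sum _ _ _) _.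
  by apply: ler_sum => k _; exact: hk.
rewrite -mulr_sumr mulrCA /C [leRHS]mulrAC ler_wpM2l ?mulr_ge0//.
have S1 : (\sum_(k < N) q ^+ k) * (1 - q) <= 1.
  by rewrite mulrC -opprB mulNr -subrX1 opprB gerBl exprn_ge0// ltW.
have dq : delta * h <= (1 - q) * (1 + delta * h) by lra.
have S0 : 0 <= \sum_(k < N) q ^+ k by apply: sumr_ge0 => k _; rewrite exprn_ge0// ltW.
rewrite ler_pdivlMr// -mulrA.
apply: le_trans (_ : (\sum_(k < N) q ^+ k) * ((1 - q) * (1 + delta * h)) <= _).
  by rewrite mulrCA ler_wpM2l// mulrC.
rewrite mulrA; apply: le_trans (_ : 1 * (1 + delta * h) <= _).
  by rewrite ler_wpM2r// addr_ge0// ltW.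
by rewrite mul1r lerD2l ger_pMr.
Qed.

Lemma dyadic_orbit_near0 x e : 0 < e -> exists N, forall n, (N <= n)%N ->
  forall s, 0 <= s <= (2 ^+ n)^-1 -> `|T s x - x| <= e.
Proof.
move=> e0; have [d d0 hd] := C0_near0 HT x e0.
have [N hN] := dyadic_le d0; exists N => n /hN nd s /andP[s0 sn].
by apply: hd; rewrite s0 (le_trans sn).
Qed.

Lemma dyadic_orbit_tail e : 0 < e -> exists N, forall n, (N <= n)%N ->
  forall x, `|T (2 ^+ n) x| <= e * `|x|.
Proof.
move=> e0; exists (Num.truncn (M / e / delta)).+1 => n Nn x.
apply: le_trans (T_decay _ _) _; first exact: exprn_ge0.
rewrite ler_wpM2r// expRN ler_pdivrMr ?expR_gt0// [leRHS]mulrC -ler_pdivrMr//.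
apply: le_trans (expR_ge1Dx _); rewrite -[leLHS]add0r lerD//.
rewrite [leRHS]mulrC -ler_pdivrMr//.
apply: ltW; apply: lt_le_trans (truncnS_gt _) _.
have -> : 2 ^+ n = (2 ^ n)%:R :> R by rewrite natrX.
rewrite ler_nat; apply: leq_trans Nn _; exact/ltnW/ltn_expl.
Qed.

Lemma orbit_sum_near h j x e : 0 < h ->
  (forall k, (k < j)%N -> `|T (k%:R * h) x - x| <= e) ->
  `|orbit_sum h j x - (j%:R * h) *: x| <= j%:R * h * e.
Proof.
move=> h0 he; rewrite /orbit_sum mulrC -scalerA -scalerBr normrZ gtr0_norm//.
rewrite -mulrA ler_wpM2l ?(ltW h0)// scaler_nat -[j in x *+ j]card_ord -sumr_const.
rewrite -sumrB mulr_natl -[j in leRHS]card_ord -sumr_const.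
apply: le_trans (ler_norm_sum _ _ _) _; apply: ler_sum => k _.
exact: he.
Qed.

(** Step 2^-n and horizon 2^n: refining the grid and extending the interval of
    integration simultaneously leaves a single limit to take. *)
Definition dyadic_resolvent n x := orbit_sum (2 ^+ n)^-1 (2 ^ n * 2 ^ n) x.

Let h0 n : 0 < (2 ^+ n)^-1 :> R. Proof. by rewrite invr_gt0 exprn_gt0. Qed.
Let h1 n : (2 ^+ n)^-1 <= 1 :> R.
Proof. by rewrite invf_le1 ?exprn_gt0// exprn_ege1// ler1n. Qed.
Let nh n : (2 ^ n)%:R * (2 ^+ n)^-1 = 1 :> R.
Proof. by rewrite natrX divff// expf_neq0// pnatr_eq0. Qed.
Let nnh n : (2 ^ n * 2 ^ n)%:R * (2 ^+ n)^-1 = 2 ^+ n :> R.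
Proof. by rewrite natrM -mulrA nh mulr1 natrX. Qed.

(** The first term is the cost of refining the grid, the second one that of
    extending the interval from [0, 2^n] to [0, 2^(n + k)]. *)
Lemma dyadic_resolvent_dist n k x e1 e2 : 0 <= e1 -> 0 <= e2 ->
  (forall s, 0 <= s <= (2 ^+ n)^-1 -> `|T s x - x| <= e1) ->
  (forall z, `|T (2 ^+ n) z| <= e2 * `|z|) ->
  `|dyadic_resolvent (n + k) x - dyadic_resolvent n x| <= C * e1 + e2 * (C * `|x|).
Proof.
move=> e10 e20 he1 he2; pose m := (n + k)%N.
have k2 : (0 < 2 ^ k)%N by rewrite expn_gt0.
have hm : (2 ^+ m)^-1 = (2 ^+ n)^-1 / (2 ^ k)%:R :> R.
  by rewrite /m exprD invfM natrX.
have hk : (2 ^ k)%:R * (2 ^+ m)^-1 = (2 ^+ n)^-1 :> R.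
  by rewrite hm mulrC divfK// pnatr_eq0 -lt0n.
have Nm : (2 ^ n * 2 ^ n * 2 ^ k <= 2 ^ m * 2 ^ m)%N.
  by rewrite /m expnD mulnACA [leqRHS]mulnA leq_pmulr.
rewrite /dyadic_resolvent -/m -(subnKC Nm) orbit_sum_cat ?h0// {1}hm.
rewrite orbit_sum_refine ?h0// addrAC -orbit_sumB ?h0//.
apply: le_trans (ler_normD _ _) _; apply: lerD.
  apply: le_trans (orbit_sum_bound _ _ (h0 n) (h1 n)) _; rewrite ler_wpM2l//.
  set y := orbit_sum _ _ x.
  have -> : (2 ^+ n)^-1^-1 *: y - x =
      (2 ^+ n)^-1^-1 *: (y - ((2 ^ k)%:R * (2 ^+ m)^-1) *: x).
    by rewrite scalerBr hk (scalerA _ _ x) mulVf ?scale1r// gt_eqF.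
  rewrite normrZ ger0_norm; last by rewrite invr_ge0 ltW.
  rewrite ler_pdivrMl// /y -hm -[in leRHS]hk; apply: orbit_sum_near => // j jk.
  apply: he1; rewrite natM0//= -hk ler_pM2r// ler_nat.
  exact: ltnW.
rewrite natrM -mulrA hk nnh; apply: le_trans (he2 _) _.
by rewrite ler_wpM2l// orbit_sum_bound.
Qed.

Lemma dyadic_resolvent_cvg x : cvgn (dyadic_resolvent ^~ x).
Proof.
apply/cauchy_cvgP/cauchy_exP => d d0.
have C1 : 0 < C + 1 by rewrite ltr_pwDr.
have Cx : 0 < C * `|x| + 1 by rewrite ltr_pwDr// mulr_ge0.
have d4 : 0 < d / 4 by rewrite divr_gt0.
have e10 := divr_gt0 d4 C1; have e20 := divr_gt0 d4 Cx.
have [N1 hN1] := dyadic_orbit_near0 x e10.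
have [N2 hN2] := dyadic_orbit_tail e20.
pose n := maxn N1 N2.
exists (dyadic_resolvent n x); exists n => // m /= nm.
rewrite -ball_normE /= distrC -(subnKC nm).
have := dyadic_resolvent_dist (m - n) (ltW e10) (ltW e20)
  (hN1 n (leq_maxl _ _)) (hN2 n (leq_maxr _ _)).
move=> /le_lt_trans; apply.
have h (a b : R) : 0 <= a -> 0 < b -> a < b -> a * (d / 4 / b) <= d / 4.
  move=> a0 b0 ab; rewrite mulrA ler_pdivrMr// mulrC ler_wpM2l ?(ltW d4)//.
  exact: ltW.
apply: le_lt_trans (_ : d / 4 + d / 4 < d); last by lra.
apply: lerD; first by apply: h => //; rewrite ltrDl.
rewrite mulrC; apply: h => //; first by rewrite mulr_ge0.
by rewrite ltrDl.
Qed.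

Definition decay_inverse x := lim (dyadic_resolvent ^~ x @ \oo).

Let B := decay_inverse.

Lemma decay_inverseP x : dyadic_resolvent n x @[n --> \oo] --> B x.
Proof. exact: dyadic_resolvent_cvg. Qed.

Lemma decay_inverse_linear : linear B.
Proof.
move=> a x y; rewrite {1}/B /decay_inverse; apply: cvg_lim => //.
have h : a *: dyadic_resolvent n x + dyadic_resolvent n y @[n --> \oo] -->
    a *: B x + B y.
  by apply: cvgD; [apply: cvgZl_tmp|]; exact: decay_inverseP.
apply: cvg_trans h; apply: near_eq_cvg; apply: nearW => n.
by rewrite /dyadic_resolvent /= orbit_sumD// orbit_sumZ.
Qed.

Lemma decay_inverse_bound x : `|B x| <= C * `|x|.
Proof.
have := @decay_inverseP x => /cvg_norm.
apply: (@closed_cvg _ _ _ _ (fun n => `|dyadic_resolvent n x|) [set z | z <= C * `|x|]).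
  exact: closed_le.
by apply: nearW => n; exact: orbit_sum_bound.
Qed.

Lemma decay_inverse_continuous : continuous B.
Proof.
exact: linear_bound_continuous decay_inverse_linear decay_inverse_bound.
Qed.

Lemma decay_inverse_cone P : closed_cone P ->
  (forall t x, 0 <= t -> P x -> P (T t x)) -> forall x, P x -> P (B x).
Proof.
move=> HP TP x Px; have := @decay_inverseP x.
apply: closed_cvg; first exact: ccone_closed HP.
apply: nearW => n; apply: (cconeZ HP); first exact: ltW.
apply: (ccone_sum (f := fun k => T (k%:R * (2 ^+ n)^-1) x)) => // k _.
by apply: TP => //; exact: natM0.
Qed.

(** At a dyadic time t, applying T(t) - 1 to the Riemann sums telescopes, up to
    the tail at time 2^m, to minus a Riemann sum over [0, t], which is close to
    - t x. Other times are reached by continuity in [decay_inverse_generator]. *)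
Lemma decay_inverse_dyadic x e d j n : (forall s, 0 <= s <= d -> `|T s x - x| <= e) ->
  j%:R * (2 ^+ n)^-1 <= d ->
  `|T (j%:R * (2 ^+ n)^-1) (B x) - B x + (j%:R * (2 ^+ n)^-1) *: x|
    <= j%:R * (2 ^+ n)^-1 * e.
Proof.
move=> he jd; set t := j%:R * _.
have t0 : 0 <= t by exact: natM0.
apply/ler_addgt0Pr => eta eta0.
have : T t (dyadic_resolvent m x) - dyadic_resolvent m x + t *: x @[m --> \oo]
    --> T t (B x) - B x + t *: x.
  apply: cvgD; last exact: cvg_cst.
  apply: cvgB (@decay_inverseP x).
  by apply: cvg_comp (@decay_inverseP x) _; exact: C0_continuous HT _ t0 _.
move=> /cvg_norm.
apply: (@closed_cvg _ _ _ _ _ [set z | z <= t * e + eta]); first exact: closed_le.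
have Cx : 0 < C * `|x| + 1 by rewrite ltr_pwDr// mulr_ge0.
have [N hN] := dyadic_orbit_tail (divr_gt0 eta0 Cx).
exists (n + N)%N => // m /= nm.
have hm : t = (j * 2 ^ (m - n))%:R * (2 ^+ m)^-1.
  rewrite natrM /t -mulrA; congr (_ * _).
  have {2}-> : m = (n + (m - n))%N by rewrite subnKC// (leq_trans _ nm)// leq_addr.
  by rewrite exprD invfM mulrCA natrX divff ?mulr1// expf_neq0// pnatr_eq0.
rewrite {1}hm /dyadic_resolvent orbit_sum_shift// nnh -addrA [_ + eta]addrC.
apply: le_trans (ler_normD _ _) _; apply: lerD.
  apply: le_trans (orbit_sum_bound _ _ (h0 m) (h1 m)) _.
  apply: le_trans (_ : C * (eta / (C * `|x| + 1) * `|x|) <= _).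
    by rewrite ler_wpM2l// hN// (leq_trans _ nm)// leq_addl.
  rewrite mulrCA mulrAC ler_pdivrMr//.
  by rewrite ler_wpM2l ?(ltW eta0)// lerDl.
rewrite addrC distrC hm; apply: orbit_sum_near => // k kj.
apply: he; rewrite natM0//=; apply: le_trans jd; rewrite -/t hm ler_pM2r//.
by rewrite ler_nat ltnW.
Qed.

Lemma decay_inverse_generator x : generator idfun T (B x, - x).
Proof.
apply/cvg_right0P => e e0 /=.
have [d d0 hd] := C0_near0 HT x e0.
exists d => // t /andP[t0 td].
suff h : `|T t (B x) - B x + t *: x| <= t * e.
  have -> : - x - t^-1 *: (T t (B x) - B x) = - (t^-1 *: (T t (B x) - B x + t *: x)).
    set u := T t (B x) - B x.
    by rewrite (scalerDr _ u) (scalerA _ _ x) mulVf ?gt_eqF// scale1r opprD addrC.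
  by rewrite normrN normrZ gtr0_norm ?invr_gt0// ler_pdivrMl.
apply/ler_addgt0Pr => eta eta0.
have eta2 : 0 < eta / 2 by rewrite divr_gt0.
have [d1 d10 hd1] := C0_uniformly_continuous HT t (B x) eta2.
have nx : 0 < `|x| + 1 by rewrite ltr_pwDr.
have d2 : 0 < Num.min d1 (eta / 2 / (`|x| + 1)).
  by rewrite lt_min d10 divr_gt0.
have [n hn] : exists n, (2 ^+ n)^-1 <= Num.min d1 (eta / 2 / (`|x| + 1)).
  by have [n hn] := dyadic_le d2; exists n; exact: (hn n (leqnn n)).
pose j := Num.truncn (t * 2 ^+ n); pose s : R := j%:R * (2 ^+ n)^-1.
have /andP[j1 j2] : j%:R <= t * 2 ^+ n < j.+1%:R.
  by apply: truncn_itv; rewrite mulr_ge0// ltW.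
have st : s <= t by rewrite ler_pdivrMr ?exprn_gt0.
have ts : t - s <= (2 ^+ n)^-1.
  rewrite lerBlDl /s -[X in _ + X]mul1r -mulrDl natr1 ler_pdivlMr ?exprn_gt0//.
  exact: ltW.
have s0 : 0 <= s by exact: natM0.
have /(_ j n (le_trans st td)) := decay_inverse_dyadic hd; rewrite -/s => hs.
have -> : T t (B x) - B x + t *: x = (T t (B x) - T s (B x) + (t - s) *: x) +
   (T s (B x) - B x + s *: x).
  by rewrite scalerBl addrACA [X in _ = X + _]addrA subrK addrNK.
apply: le_trans (ler_normD _ _) _; rewrite addrC; apply: lerD.
  by apply: le_trans hs _; rewrite ler_wpM2r// ltW.
apply: le_trans (ler_normD _ _) _; rewrite [leRHS]splitr; apply: lerD.
  apply: hd1; rewrite ?(ltW t0) ?s0//= ger0_norm ?subr_ge0//.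
  by apply: le_trans ts _; apply: le_trans hn _; rewrite ge_min lexx.
rewrite normrZ ger0_norm ?subr_ge0//.
apply: le_trans (_ : (eta / 2 / (`|x| + 1)) * `|x| <= _).
  rewrite ler_wpM2r//; apply: le_trans ts _; apply: le_trans hn _.
  by rewrite ge_min lexx orbT.
rewrite mulrAC ler_pdivrMr//.
by rewrite ler_wpM2l ?(ltW eta2)// lerDl.
Qed.

(** For the step h, the Riemann sum of (T(h) y - y) / h telescopes to
    T(2^n) y - y, and (T(h) y - y) / h -> z. *)
Lemma decay_inverse_of_generator y z : generator idfun T (y, z) -> B z = - y.
Proof.
move=> /cvg_right0P gy; rewrite /B /decay_inverse; apply: cvg_lim => //.
apply/cvgrPdist_le => e e0; have e2 : 0 < e / 2 by rewrite divr_gt0.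
have C1 : 0 < C + 1 by rewrite ltr_pwDr.
have y1 : 0 < `|y| + 1 by rewrite ltr_pwDr.
have [d d0 hd] := gy _ (divr_gt0 e2 C1).
have [N1 hN1] := dyadic_le d0.
have [N2 hN2] := dyadic_orbit_tail (divr_gt0 e2 y1).
exists (maxn N1 N2) => // n /= nN; pose h : R := (2 ^+ n)^-1.
pose w := h^-1 *: (T h y - y).
have hw : dyadic_resolvent n w = T (2 ^+ n) y - y.
  rewrite /dyadic_resolvent /w orbit_sumZ ?h0// orbit_sumB ?h0//.
  have := orbit_sum_shift (2 ^ n * 2 ^ n) 1 y (h0 n); rewrite mul1r -/h => <-.
  rewrite nnh !orbit_sum1 (C0_opZ HT) ?exprn_ge0// -scalerBr scalerA mulVf ?scale1r//.
  by rewrite gt_eqF// h0.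
rewrite -[z](subrK w) /dyadic_resolvent orbit_sumD ?h0//.
rewrite -/(dyadic_resolvent n w) hw.
have -> : - y - (orbit_sum (2 ^- n) (2 ^ n * 2 ^ n) (z - w) + (T (2 ^+ n) y - y)) =
  - orbit_sum (2 ^- n) (2 ^ n * 2 ^ n) (z - w) - T (2 ^+ n) y.
  by rewrite opprD opprB addrCA addKr.
apply: le_trans (ler_normD _ _) _; rewrite !normrN [leRHS]splitr; apply: lerD.
  apply: le_trans (orbit_sum_bound _ _ (h0 n) (h1 n)) _.
  apply: le_trans (_ : C * (e / 2 / (C + 1)) <= _).
    rewrite ler_wpM2l//; apply: hd; rewrite h0 hN1//.
    by apply: leq_trans nN; exact: leq_maxl.
  by rewrite mulrA ler_pdivrMr// mulrC ler_wpM2l ?(ltW e2)// lerDl.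
apply: le_trans (hN2 _ _ _) _; first by apply: leq_trans nN; exact: leq_maxr.
by rewrite mulrAC ler_pdivrMr// ler_wpM2l ?(ltW e2)// lerDl.
Qed.

Lemma decay_inverseE x y : B y = x <-> generator idfun T (x, - y).
Proof.
split=> [<-|/decay_inverse_of_generator h]; first exact: decay_inverse_generator.
have lB := decay_inverse_linear.
apply: oppr_inj; rewrite -h; have := lB (- 1) y 0.
have -> : B 0 = 0.
  by apply/eqP; rewrite -normr_le0 (le_trans (decay_inverse_bound 0))// normr0 mulr0.
by rewrite !addr0 !scaleN1r.
Qed.

End decaying_semigroup.

(** * Rescaling, and resolvents preserving a cone *)

Section multiplied_semigroup.
Context {R : realType} {K : numFieldType} (iota : {rmorphism R -> K}).
Context {V : completeNormedModType K}.
Implicit Types (T : R -> V -> V) (c : R -> K) (l : K).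

Definition multiplied c T : R -> V -> V := fun t x => c t *: T t x.

Lemma C0_multiplied c T : c 0 = 1 -> (forall s t, c (s + t) = c s * c t) ->
  c t @[t --> 0^'+] --> (1 : K) -> C0_semigroup T -> C0_semigroup (multiplied c T).
Proof.
move=> c0 cD c1 HT; split.
- move=> t t0 a x y; rewrite /multiplied (C0_linear HT t0) scalerDr !scalerA.
  by rewrite [c t * a]mulrC.
- move=> t t0 x; apply: cvgZl_tmp; exact: C0_continuous HT t t0 x.
- by move=> x; rewrite /multiplied c0 scale1r (C0_at0 HT).
- move=> s t x s0 t0; rewrite /multiplied (C0_add HT)// cD.
  have := C0_linear HT s0 (c t) (T t x) 0.
  have -> : T s 0 = 0.
    by have := C0_linear HT s0 (-1) 0 0; rewrite scaler0 addr0 scaleN1r addNr.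
  by rewrite !addr0 => ->; rewrite scalerA.
- move=> x; rewrite -[X in _ --> X]scale1r; apply: cvgZ => //.
  exact: C0_strongly_continuous HT x.
Qed.

Lemma generator_multiplied_sub c l T x z : c t @[t --> 0^'+] --> (1 : K) ->
  iota t^-1 * (c t - 1) @[t --> 0^'+] --> - l ->
  generator iota T (x, z) -> generator iota (multiplied c T) (x, z - l *: x).
Proof.
rewrite /generator /multiplied /= => c1 cl Txz.
have h : c t *: (iota t^-1 *: (T t x - x)) + (iota t^-1 * (c t - 1)) *: x
    @[t --> 0^'+] --> 1 *: z + (- l) *: x.
  by apply: cvgD; [exact: cvgZ|exact: cvgZr_tmp].
rewrite -{1}[z]scale1r -scaleNr; apply: cvg_trans h.
apply: near_eq_cvg; near=> t.
rewrite -scalerA scalerA [c t * _]mulrC -scalerA -scalerDr; congr (_ *: _).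
by rewrite scalerBr scalerBl scale1r addrA subrK.
Unshelve. all: by end_near. Qed.

(** The product rule at 0: the derivative of c(t) T(t) is A - l if that of c is
    - l. The converse inclusion is the same rule for the inverse multiplier. *)
Lemma generator_multiplied c c' l T x z :
  (forall t, c t * c' t = 1) ->
  c t @[t --> 0^'+] --> (1 : K) -> c' t @[t --> 0^'+] --> (1 : K) ->
  iota t^-1 * (c t - 1) @[t --> 0^'+] --> - l ->
  iota t^-1 * (c' t - 1) @[t --> 0^'+] --> l ->
  generator iota (multiplied c T) (x, z) <-> generator iota T (x, z + l *: x).
Proof.
move=> cc' c1 c'1 cl c'l; split; last first.
  by move=> /(generator_multiplied_sub c1 cl); rewrite addrK.
rewrite -[X in _ --> X]opprK in c'l.
move=> /(generator_multiplied_sub c'1 c'l); rewrite scaleNr opprK.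
congr (generator _ _ _); apply/funext => t; apply/funext => y.
by rewrite /multiplied scalerA mulrC cc' scale1r.
Qed.

Lemma cvg1_of_derive c l : iota t @[t --> 0^'+] --> (0 : K) ->
  iota t^-1 * (c t - 1) @[t --> 0^'+] --> l -> c t @[t --> 0^'+] --> (1 : K).
Proof.
move=> t0 h.
have h1 : iota t * (iota t^-1 * (c t - 1)) + 1 @[t --> 0^'+] --> (0 * l + 1 : K).
  by apply: cvgD; [exact: cvgM|exact: cvg_cst].
rewrite mul0r add0r in h1; apply: cvg_trans h1; apply: near_eq_cvg; near=> t.
by rewrite mulrA -rmorphM divff ?rmorph1 ?mul1r ?subrK// gt_eqF.
Unshelve. all: by end_near. Qed.

End multiplied_semigroup.

Section exponential_multiplier.
Local Open Scope complex_scope.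
Context {R : realType}.
Implicit Types (s t : R) (l : R[i]).
Local Notation Ctop := (Num.NumField.sort (R[i] : numFieldType)).

Lemma derive_cvg_right (f : R -> R) (df : R) : is_derive (0 : R) 1 f df ->
  t^-1 * (f t - f 0) @[t --> 0^'+] --> df.
Proof.
move=> [fd <-].
have : t^-1 *: (f (t *: 1 + 0) - f 0) @[t --> 0^'] --> 'D_1 f 0 by exact: fd.
move=> /cvg_dnbhs_at_right; apply: cvg_trans; apply: near_eq_cvg.
by apply: nearW => t; rewrite addr0 [t *: 1]mulr1.
Qed.

Lemma cvg_complex (T : Type) (F : set_system T) {FF : Filter F} (f g : T -> R) (a b : R) :
  f t @[t --> F] --> a -> g t @[t --> F] --> b ->
  (f t +i* g t : Ctop) @[t --> F] --> (a +i* b : Ctop).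
Proof.
move=> /cvgrPdist_lt fa /cvgrPdist_lt gb; apply/cvgrPdist_lt => e.
rewrite ltcE /= => /andP[/eqP e_im e0].
have d2 : 0 < complex.Re e / 2 by rewrite divr_gt0.
have eE : e = (complex.Re e)%:C by case: e e_im {e0 d2} => ? ? /= ->.
near=> t; rewrite eE.
have -> : a +i* b - (f t +i* g t) = (a - f t) +i* (b - g t) by [].
rewrite ltcR /=.
apply: le_lt_trans (_ : `|a - f t| + `|b - g t| < _).
  rewrite -[leRHS]ger0_norm ?addr_ge0// -sqrtr_sqr ler_wsqrtr//.
  rewrite [leRHS]sqrrD !real_normK ?num_real// addrAC lerDl mulrn_wge0//.
rewrite [complex.Re e]splitr ltrD//; near: t; [exact: fa|exact: gb].
Unshelve. all: by end_near. Qed.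

(** The complex exponential e^(-lt). *)
Definition cexpN l t : R[i] :=
  (expR (- (complex.Re l * t)) * cos (complex.Im l * t)) +i*
  (- (expR (- (complex.Re l * t)) * sin (complex.Im l * t))).

Lemma cexpN0 l : cexpN l 0 = 1.
Proof. by rewrite /cexpN !mulr0 oppr0 expR0 cos0 sin0 mulr1 mulr0 oppr0. Qed.

Lemma cexpND l s t : cexpN l (s + t) = cexpN l s * cexpN l t.
Proof.
rewrite /cexpN; simpc; rewrite !mulrDr opprD expRD cosD sinD.
by congr (_ +i* _); ring.
Qed.

Lemma cexpNN l t : cexpN l t * cexpN (- l) t = 1.
Proof.
rewrite /cexpN; simpc; case: l => a b /=; rewrite !mulNr opprK cosN sinN expRN.
have h : expR (a * t) != 0 by rewrite gt_eqF// expR_gt0.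
have := cos2Dsin2 (b * t) => h2.
congr (_ +i* _); last by field.
by rewrite -h2; field.
Qed.

Lemma cexpN_real w t : cexpN w%:C t = (expR (- w * t))%:C.
Proof. by rewrite /cexpN /= mul0r cos0 sin0 mulr1 mulr0 oppr0 mulNr. Qed.

Lemma norm_cexpN l t : `|cexpN l t| = (expR (- (complex.Re l * t)))%:C.
Proof.
rewrite /cexpN; case: l => a b /=; set r := expR _.
congr (_%:C) => /=; rewrite sqrrN !exprMn -mulrDr cos2Dsin2 mulr1 sqrtr_sqr ger0_norm//.
exact: expR_ge0.
Qed.

Lemma cexpN_derive l :
  ((t^-1)%:C * (cexpN l t - 1) : Ctop) @[t --> 0^'+] --> (- l : Ctop).
Proof.
case: l => a b.
pose f t := expR (- (a * t)) * cos (b * t).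
pose g t := - (expR (- (a * t)) * sin (b * t)).
have dl (k : R) : is_derive (0 : R) 1 (fun t : R => k * t) k.
  rewrite -[X in is_derive _ _ _ X]mulr1.
  exact: (@is_deriveZ R R R id k 0 1 1 (is_derive_id _ _)).
have dE : is_derive (0 : R) 1 (fun t => expR (- (a * t))) (- a).
  have := is_derive1_comp (is_derive_expR (- a * 0)) (dl (- a)).
  rewrite mulr0 expR0 mul1r; congr (is_derive _ _ _ _).
  by apply/funext => t /=; rewrite mulNr.
have dC : is_derive (0 : R) 1 (fun t => cos (b * t)) 0.
  have := is_derive1_comp (is_derive_cos (b * 0)) (dl b).
  by rewrite mulr0 sin0 oppr0 mul0r.
have dS : is_derive (0 : R) 1 (fun t => sin (b * t)) b.
  have := is_derive1_comp (is_derive_sin (b * 0)) (dl b).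
  by rewrite mulr0 cos0 mul1r.
have hf : is_derive (0 : R) 1 f (- a).
  have := is_deriveM dE dC.
  by rewrite !mulr0 oppr0 expR0 cos0 scaler0 add0r scale1r.
have hg : is_derive (0 : R) 1 g (- b).
  have := is_deriveN (is_deriveM dE dS).
  by rewrite !mulr0 oppr0 expR0 sin0 scale0r addr0 scale1r.
have h : ((t^-1 * (f t - f 0)) +i* (t^-1 * (g t - g 0)) : Ctop) @[t --> 0^'+] -->
    ((- a) +i* (- b) : Ctop).
  by apply: cvg_complex; exact: derive_cvg_right.
apply: cvg_trans h; apply: near_eq_cvg; apply: nearW => t.
rewrite /cexpN -/(f t) -/(g t) /= /f /g !mulr0 oppr0 expR0 cos0 sin0 mulr1 mulr0 oppr0.
rewrite subr0; apply/eqP; rewrite eq_complex /=.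
by rewrite !mul0r subr0 addr0 oppr0 addr0 !eqxx.
Qed.

Lemma cexpN_cvg1 l : (cexpN l t : Ctop) @[t --> 0^'+] --> (1 : Ctop).
Proof.
have h := @cexpN_derive l.
have t0 : real_complex R t @[t --> 0^'+] --> (0 : Ctop).
  apply: (@cvg_complex _ _ _ id (fun=> 0)); last exact: cvg_cst.
  by apply: cvg_at_right_filter; exact: cvg_id.
apply: cvg1_of_derive t0 h.
Qed.

Lemma generator_cexpN (V : completeNormedModType R[i]) (T : R -> V -> V) l x z :
  generator (real_complex R) (multiplied (cexpN l) T) (x, z) <->
  generator (real_complex R) T (x, z + l *: x).
Proof.
apply: (@generator_multiplied _ _ (real_complex R) V _ (cexpN (- l))).
- exact: cexpNN.
- exact: cexpN_cvg1.
- exact: cexpN_cvg1.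
- exact: cexpN_derive.
- by have := @cexpN_derive (- l); rewrite opprK.
Qed.

Lemma C0_cexpN (V : completeNormedModType R[i]) (T : R -> V -> V) l :
  C0_semigroup T -> C0_semigroup (multiplied (cexpN l) T).
Proof.
apply: C0_multiplied; [exact: cexpN0|exact: cexpND|exact: cexpN_cvg1].
Qed.

End exponential_multiplier.

Section real_rescaling.
Context {R : realType} {F : completeNormedModType R}.
Implicit Types (w : R) (T : R -> F -> F).

Let expN_derive w : t^-1 * (expR (- w * t) - 1) @[t --> 0^'+] --> - w.
Proof.
have d : is_derive (0 : R) 1 (fun t => expR (- w * t)) (- w).
  have dl : is_derive (0 : R) 1 (fun t : R => - w * t) (- w).
    rewrite -[X in is_derive _ _ _ X]mulr1.
    exact: (@is_deriveZ R R R id (- w) 0 1 1 (is_derive_id _ _)).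
  have := is_derive1_comp (is_derive_expR (- w * 0)) dl.
  by rewrite mulr0 expR0 mul1r.
by have := derive_cvg_right d; rewrite mulr0 expR0.
Qed.

Let expN_cvg1 w : expR (- w * t) @[t --> 0^'+] --> (1 : R).
Proof.
apply: cvg_at_right_filter; rewrite -[X in _ --> X]expR0 -[X in expR X](mulr0 (- w)).
apply: cvg_comp; last exact: continuous_expR.
by apply: cvgMl_tmp; exact: cvg_id.
Qed.

Lemma generator_rescaled w T x z :
  generator idfun (rescaled idfun w T) (x, z) <-> generator idfun T (x, z + w *: x).
Proof.
apply: (@generator_multiplied _ _ idfun F _ (fun t => expR (- (- w) * t))).
- by move=> t; rewrite -expRD -mulrDl addrN mul0r expR0.
- exact: expN_cvg1.
- exact: expN_cvg1.
- exact: expN_derive.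
- by have := @expN_derive (- w); rewrite opprK.
Qed.

Lemma C0_rescaled w T : C0_semigroup T -> C0_semigroup (rescaled idfun w T).
Proof.
apply: (@C0_multiplied _ _ F (fun t => expR (- w * t))).
- by rewrite mulr0 expR0.
- by move=> s t; rewrite mulrDr expRD.
- exact: expN_cvg1.
Qed.

End real_rescaling.

Section resolvent_positivity.
Context {R : realType} {F : completeNormedModType R} {T : R -> F -> F}.
Hypothesis HT : C0_semigroup T.

Definition resolvent_at (A : set (F * F)) (mu : R) (B : F -> F) : Prop :=
  [/\ linear B, continuous B &
    forall x y, B y = x <-> exists2 Ax, A (x, Ax) & mu *: x - Ax = y].

Let A := generator idfun T.

(** The resolvent identity. *)
Lemma resolvent_shift mu nu B y x : resolvent_at A mu B ->
  (exists2 Ax, A (x, Ax) & nu *: x - Ax = y) -> x = B (y + (mu - nu) *: x).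
Proof.
move=> [_ _ HB] [Ax hx <-]; apply/esym/HB; exists Ax => //.
by rewrite addrAC -scalerDl [nu + _]addrC subrK.
Qed.

(** Above the exponential growth rate of T, the resolvent is the limit of
    positive combinations of the operators e^(- mu t) T(t). *)
Lemma large_resolvent_preserves_cone : exists2 mu, 0 <= mu & forall B, resolvent_at A mu B ->
  forall Q, closed_cone Q -> (forall t x, 0 <= t -> Q x -> Q (T t x)) ->
  forall x, Q x -> Q (B x).
Proof.
have [M [a hM]] := C0_exponential_bound HT.
pose mu : R := `|a| + 1; exists mu; first by rewrite addr_ge0.
move=> B [_ _ HB] Q HQ TQ x Qx.
pose S := rescaled idfun mu T.
have HS : C0_semigroup S by exact: C0_rescaled.
have S_decay t y : 0 <= t -> `|S t y| <= `|M| * expR (- (1 * t)) * `|y|.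
  move=> t0; rewrite normrZ ger0_norm ?expR_ge0//.
  apply: le_trans (_ : expR (- mu * t) * (M * expR (a * t) * `|y|) <= _).
    by rewrite ler_wpM2l ?expR_ge0// hM.
  rewrite mulrA ler_wpM2r// mulrCA -expRD.
  apply: le_trans (_ : `|M| * expR (- mu * t + a * t) <= _).
    by rewrite ler_wpM2r ?expR_ge0// ler_norm.
  rewrite ler_wpM2l// ler_expR -mulNr -mulrDl ler_wpM2r// /mu opprD addrAC.
  by rewrite gerDr addrC subr_le0 ler_norm.
have M0 := normr_ge0 M.
have d1 : 0 < 1 :> R by [].
have -> : B x = @decay_inverse R F S x.
  apply/HB; exists (- x + mu *: @decay_inverse R F S x); last by rewrite opprD addrCA subrr addr0 opprK.
  apply/generator_rescaled; exact: (decay_inverse_generator HS M0 d1 S_decay).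
apply: (decay_inverse_cone HS M0 d1 S_decay HQ) => // t y t0 Qy.
by apply: (cconeZ HQ); [exact: expR_ge0|exact: TQ].
Qed.

Lemma resolvent_bound mu B : resolvent_at A mu B ->
  exists2 M, 0 < M & forall x, `|B x| <= M * `|x|.
Proof. by case=> lB cB _; exact: linear_continuous_bound. Qed.

(** By the resolvent identity, x = R(nu) q is the fixed point of
    x |-> R(mu) (q + (mu - nu) x), a contraction that maps Q to itself because
    mu - nu >= 0; the iterates from 0 form the Neumann series. *)
Lemma resolvent_preserves_cone_below mu nu B B' M Q : closed_cone Q ->
  resolvent_at A mu B -> resolvent_at A nu B' -> nu <= mu ->
  (forall x, `|B x| <= M * `|x|) -> 0 < M -> (mu - nu) * M < 1 ->
  (forall x, Q x -> Q (B x)) -> forall x, Q x -> Q (B' x).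
Proof.
move=> HQ HB HB' numu hM M0 small BQ q Qq; set x := B' q.
have xE : x = B (q + (mu - nu) *: x).
  by apply: resolvent_shift HB _; case: HB' => _ _ h; apply/h.
have mn0 : 0 <= mu - nu by rewrite subr_ge0.
pose s := fix s n := if n is m.+1 then B (q + (mu - nu) *: s m) else (0 : F).
have sQ n : Q (s n).
  elim: n => [|n ih]; first exact: ccone0.
  by apply: BQ; apply: (cconeD HQ) => //; apply: (cconeZ HQ).
pose th := (mu - nu) * M.
have th0 : 0 <= th by rewrite mulr_ge0// ltW.
have BB y z : B y - B z = B (y - z).
  have [lB _ _] := HB; have := lB (- 1) z y.
  by rewrite !scaleN1r [- z + y]addrC => ->; rewrite addrC.
have sx n : `|x - s n| <= th ^+ n * `|x|.
  elim: n => [|n ih]; first by rewrite subr0 expr0 mul1r.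
  rewrite {1}xE /= BB opprD addrACA subrr add0r -scalerBr.
  apply: le_trans (hM _) _; rewrite normrZ ger0_norm// exprS -mulrA /th.
  rewrite mulrA [M * _]mulrC ler_wpM2l//.
apply: closed_approx (ccone_closed HQ) _ => e e0.
have [n hn] : exists n, th ^+ n * `|x| <= e.
  have x1 : 0 < `|x| + 1 by rewrite ltr_pwDr.
  have := @cvg_expr R th; rewrite ger0_norm// => /(_ small).
  move=> /cvgrPdist_le/(_ _ (divr_gt0 e0 x1))[N _ /(_ N (leqnn N))] /=.
  rewrite sub0r normrN ger0_norm ?exprn_ge0// => h; exists N.
  apply: le_trans (ler_wpM2r _ h) _ => //.
  by rewrite mulrAC ler_pdivrMr// ler_wpM2l ?(ltW e0)// lerDl.
by exists (s n) => //; exact: le_trans (sx n) hn.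
Qed.

(** Consider the infimum m of the mu >= 0 whose resolvent preserves Q. Close to
    m the resolvents have norm at most twice the norm M of R(m), so that a
    single Neumann step from some nu near m reaches below m, or reaches 0. *)
Lemma resolvent0_preserves_cone Q B0 : closed_cone Q ->
  (forall t x, 0 <= t -> Q x -> Q (T t x)) ->
  (forall mu, 0 <= mu -> exists B, resolvent_at A mu B) ->
  resolvent_at A 0 B0 -> forall x, Q x -> Q (B0 x).
Proof.
move=> HQ TQ HR HB0.
pose S := [set mu : R | 0 <= mu /\
  forall B, resolvent_at A mu B -> forall x, Q x -> Q (B x)].
suff [_ h] : S 0 by exact: h.
have S_lb : has_lbound S by exists 0 => mu [].
have S_inf : has_inf S.
  split=> //; have [mu mu0 hmu] := large_resolvent_preserves_cone.
  by exists mu; split => // B HB; exact: hmu.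
pose m := inf S.
have m0 : 0 <= m by apply: lb_le_inf; [case: S_inf|move=> mu []].
have [Bm HBm] := HR m m0; have [M M0 hM] := resolvent_bound HBm.
(* With |m - nu| < d the resolvent at nu is bounded by 2M, and the step of
   length at most 3d/2 from nu to mu contracts by 3/2 d 2M = 3/4. *)
pose d := (4 * M)^-1.
have d0 : 0 < d by rewrite invr_gt0 mulr_gt0.
have dM : d * M = 4^-1 by rewrite /d; field; rewrite gt_eqF.
have [nu [nu0 Snu] num] := inf_adherent d0 S_inf; rewrite -/m in num.
have mnu : m <= nu by exact: ge_inf.
have [Bn HBn] := HR nu nu0.
have hBn y : `|Bn y| <= 2 * M * `|y|.
  have xE : Bn y = Bm (y + (m - nu) *: Bn y).
    by apply: resolvent_shift HBm _; case: HBn => _ _ h; apply/h.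
  have := hM (y + (m - nu) *: Bn y); rewrite -xE => h.
  have h2 : `|y + (m - nu) *: Bn y| <= `|y| + d * `|Bn y|.
    apply: le_trans (ler_normD _ _) _; rewrite lerD2l normrZ ler_wpM2r//.
    by rewrite distrC ger0_norm ?subr_ge0// lerBlDl ltW.
  have h3 : `|Bn y| <= M * `|y| + 4^-1 * `|Bn y|.
    apply: le_trans h _; apply: le_trans (ler_wpM2l (ltW M0) h2) _.
    by rewrite mulrDr mulrA [M * d]mulrC dM.
  have : 0 <= M * `|y| by rewrite mulr_ge0// ltW.
  by rewrite -mulrA; lra.
pose mu := Num.max 0 (m - d / 2).
have mu0 : 0 <= mu by rewrite le_max lexx.
have mum : m - d / 2 <= mu by rewrite le_max lexx orbT.
have munu : mu <= nu.
  by rewrite ge_max nu0/= (le_trans _ mnu)// gerBl divr_ge0// ltW.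
have Smu : S mu.
  split=> // B HB; apply: (resolvent_preserves_cone_below HQ HBn HB munu hBn).
  - by rewrite mulr_gt0.
  - apply: le_lt_trans (_ : (3 / 2 * d) * (2 * M) < 1).
      rewrite ler_wpM2r ?mulr_ge0 ?(ltW M0)//.
      by have := num; have := mum; lra.
    have -> : 3 / 2 * d * (2 * M) = 3 * (d * M) by field.
    by rewrite dM; lra.
  - exact: Snu.
have : m <= mu by exact: ge_inf.
rewrite /mu le_max => /orP[m00|]; last first.
  by rewrite lerBrDr gerDl leNgt divr_gt0.
have mu00 : mu = 0.
  rewrite /mu; apply/max_idPl; rewrite (le_trans _ m00)// gerBl divr_ge0//.
  exact: ltW.
by rewrite -mu00.
Qed.

End resolvent_positivity.

(** * Suprema of curves in AM-spaces *)

Section order_limits.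
Context {R : realType} {E : banachLatticeType R}.
Implicit Types x y z u d : E.

Lemma vge0_approx x :
  (forall e, 0 < e -> exists2 z, 0 <=v z & `|x - z| <= e) -> 0 <=v x.
Proof.
move=> h; suff h0 : vsup (- x) 0 = 0.
  by rewrite -[x]opprK -oppr0; apply: vleN2; rewrite -h0; exact: vle_supl.
apply/eqP; rewrite -normr_le0; apply/ler_addgt0Pr => e e0; rewrite add0r.
have [z z0 xz] := h e e0; apply: le_trans xz.
have -> : vsup (- x) 0 = vsup (- x) 0 - vsup (- z) 0.
  suff -> : vsup (- z) 0 = 0 by rewrite subr0.
  apply: vle_anti; last exact: vle_supr.
  apply/vsup_le; split; last exact: vle_refl.
  by rewrite -[X in _ <=v X]oppr0; exact: vleN2.
by apply: le_trans (vpos_lipschitz _ _) _; rewrite opprK addrC distrC.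
Qed.

Lemma vle_norm_absD x d1 d2 : x <=v d1 -> - x <=v d2 -> 0 <=v d1 -> 0 <=v d2 ->
  `|x| <= `|d1| + `|d2|.
Proof.
move=> x1 x2 d10 d20; apply: le_trans (ler_normD _ _); apply: vle_norm_abs.
apply: vabs_le.
  by rewrite -[X in X <=v _]addr0; exact: vleD.
by rewrite -[X in X <=v _]add0r; exact: vleD.
Qed.

Lemma vabs_triangle x y : vabs x <=v vabs y + vabs (x - y).
Proof.
apply: vabs_le.
  by rewrite -[X in X <=v _](subrK y) addrC; apply: vleD; exact: vle_abs.
rewrite -[X in - X](subrK y) opprD addrC.
by apply: vleD; exact: vle_absN.
Qed.

Definition vsup_seq (l : seq E) : E := foldr (@vsup R E) 0 l.

Lemma vsup_seq_ge0 l : 0 <=v vsup_seq l.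
Proof.
elim: l => [|x l ih] /=; first exact: vle_refl.
by apply: vle_trans ih _; exact: vle_supr.
Qed.

Lemma vsup_seq_ub l x : x \in l -> x <=v vsup_seq l.
Proof.
elim: l => //= y l ih; rewrite inE => /predU1P[->|/ih h]; first exact: vle_supl.
by apply: vle_trans h _; exact: vle_supr.
Qed.

End order_limits.

Section AM_curves.
Context {R : realType} {E : banachLatticeType R}.
Hypothesis AM : AM_space E.
Implicit Types (x y z u d : E) (e K : R).

Lemma AM_norm_vsup_seq l K : 0 <= K ->
  (forall x, x \in l -> 0 <=v x /\ `|x| <= K) -> `|vsup_seq l| <= K.
Proof.
move=> K0; elim: l => [|x l ih] h /=; first by rewrite normr0.
have [x0 xK] := h x (mem_head _ _).
rewrite AM//; last exact: vsup_seq_ge0.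
rewrite ge_max xK ih// => y yl; apply: h; by rewrite inE yl orbT.
Qed.

(** In an AM-space errors do not accumulate: finitely many errors of norm at
    most e have a supremum of norm at most e. *)
Lemma AM_vsup_seq_le l u e : 0 <= e -> 0 <=v u ->
  (forall y, y \in l -> exists d, [/\ 0 <=v d, `|d| <= e & y <=v u + d]) ->
  exists d, [/\ 0 <=v d, `|d| <= e & vsup_seq l <=v u + d].
Proof.
move=> e0 u0; elim: l => [|y l ih] h /=.
  by exists 0; rewrite normr0 addr0; split => //; exact: vle_refl.
have [d1 [d10 d1e yd1]] := h y (mem_head _ _).
have [z zl|d2 [d20 d2e ld2]] := ih; first by apply: h; rewrite inE zl orbT.
exists (vsup d1 d2); split.
- by apply: vle_trans d10 _; exact: vle_supl.
- by rewrite AM// ge_max d1e.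
- apply/vsup_le; split.
    by apply: vle_trans yd1 _; apply: vleD2l; exact: vle_supl.
  by apply: vle_trans ld2 _; apply: vleD2l; exact: vle_supr.
Qed.

(** A compact set in an AM-space has a supremum, and its norm is not larger than
    that of the set. The supremum is obtained as the limit of the suprema over
    uniform grids, which form a Cauchy sequence by [AM_vsup_seq_le]. *)
Lemma AM_curve_dominated (x : R -> E) (p q K : R) : p <= q -> 0 <= K ->
  (forall r, p <= r <= q -> `|x r| <= K) ->
  (forall e, 0 < e -> exists2 d, 0 < d & forall r s, p <= r <= q -> p <= s <= q ->
     `|r - s| <= d -> `|x r - x s| <= e) ->
  exists g, [/\ 0 <=v g, `|g| <= K & forall r, p <= r <= q -> x r <=v g].
Proof.
move=> pq K0 xK xuc.
pose h n : R := (q - p) / n.+1%:R.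
have h0 n : 0 <= h n by rewrite divr_ge0// subr_ge0.
have grid n k : (k <= n.+1)%N -> p <= p + k%:R * h n <= q.
  move=> kn; rewrite lerDl mulr_ge0//= -lerBrDl.
  by rewrite /h mulrCA ler_piMr ?subr_ge0// ler_pdivrMr// mul1r ler_nat.
pose l n := [seq vabs (x (p + k%:R * h n)) | k <- iota 0 n.+2].
pose g n := vsup_seq (l n).
have lP n y : y \in l n -> exists2 r, p <= r <= q & y = vabs (x r).
  move=> /mapP[k]; rewrite mem_iota add0n ltnS => kn ->.
  by exists (p + k%:R * h n) => //; exact: grid.
have gK n : `|g n| <= K.
  apply: AM_norm_vsup_seq => // _ /lP[r rpq ->]; split; first exact: vabs_ge0.
  by rewrite norm_vabs; exact: xK.
have dom e : 0 < e -> exists N, forall n, (N <= n)%N -> forall r, p <= r <= q ->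
    exists d, [/\ 0 <=v d, `|d| <= e & vabs (x r) <=v g n + d].
  move=> e0; have [d d0 hd] := xuc e e0.
  exists (Num.truncn ((q - p) / d)) => n Nn r rpq.
  have hn : h n <= d.
    rewrite ler_pdivrMr// mulrC -ler_pdivrMr//.
    by apply: ltW; apply: lt_le_trans (truncnS_gt _) _; rewrite ler_nat.
  have [k kn rk] : exists2 k, (k <= n.+1)%N & `|r - (p + k%:R * h n)| <= h n.
    have /andP[pr rq] := rpq; have rp0 : 0 <= r - p by rewrite subr_ge0.
    have [hn0|hn1] := eqVneq (h n) 0.
      exists 0%N => //; rewrite mul0r addr0 ger0_norm// lerBlDr.
      have : q - p = 0.
        by move/eqP : hn0; rewrite mulf_eq0 invr_eq0 pnatr_eq0 orbF => /eqP.
      by move=> /eqP; rewrite subr_eq0 => /eqP qp; rewrite -qp (le_trans rq)// lerDr.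
    have hn2 : 0 < h n by rewrite lt_neqAle eq_sym hn1 h0.
    have rh0 : 0 <= (r - p) / h n by rewrite divr_ge0.
    have /andP[k1 k2] := truncn_itv rh0.
    exists (Num.truncn ((r - p) / h n)).
      rewrite -(ler_nat R); apply: le_trans k1 _; rewrite ler_pdivrMr//.
      by rewrite mulrC divfK// lerD2r.
    rewrite ler_pdivlMr// in k1; rewrite ltr_pdivrMr// -natr1 mulrDl mul1r in k2.
    by rewrite opprD addrA ger0_norm ?subr_ge0// lerBlDl ltW.
  exists (vabs (x r - x (p + k%:R * h n))); split; first exact: vabs_ge0.
    by rewrite norm_vabs; apply: hd => //; [exact: grid|exact: le_trans hn].
  apply: vle_trans (vabs_triangle _ (x (p + k%:R * h n))) _.
  apply: vleD2r; apply: vsup_seq_ub; apply/mapP; exists k => //.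
  by rewrite mem_iota add0n ltnS.
have gdom e : 0 < e -> exists N, forall m n, (N <= n)%N ->
    exists d, [/\ 0 <=v d, `|d| <= e & g m <=v g n + d].
  move=> e0; have [N hN] := dom e e0; exists N => m n Nn.
  apply: AM_vsup_seq_le (ltW e0) (vsup_seq_ge0 _) _ => _ /lP[r rpq ->].
  exact: hN.
have g_cvg : cvgn g.
  apply/cauchy_cvgP/cauchy_exP => e e0.
  have e3 : 0 < e / 3 by rewrite divr_gt0.
  have [N hN] := gdom _ e3; exists (g N); exists N => // n /= Nn.
  rewrite -ball_normE /=.
  have [d1 [d10 d1e h1]] := hN N n Nn; have [d2 [d20 d2e h2]] := hN n N (leqnn _).
  have subl u v w : u <=v v + w -> u - v <=v w.
    by move=> /(@vleD2r _ _ _ _ (- v)); rewrite addrAC subrr add0r.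
  have := vle_norm_absD (subl _ _ _ h1) _ d10 d20; rewrite opprB.
  by move=> /(_ (subl _ _ _ h2)); lra.
have g_lim : g n @[n --> \oo] --> lim (g @ \oo) by exact: g_cvg.
exists (lim (g @ \oo)); split.
- by apply: vge0_closed g_lim _ => n; exact: vsup_seq_ge0.
- have /cvg_norm := g_lim.
  apply: (@closed_cvg _ _ _ _ (fun n => `|g n|) [set z | z <= K]).
    exact: closed_le.
  by apply: nearW => n; exact: gK.
- move=> r rpq; apply/vsubr_ge0; apply: vge0_approx => e e0.
  have e2 : 0 < e / 2 by rewrite divr_gt0.
  have [N hN] := dom _ e2.
  have /cvgrPdist_le/(_ _ e2)[N' _ hN'] := g_lim.
  have := hN' (maxn N N') (leq_maxr _ _) => /= hg.
  have [d [d0 de xd]] := hN _ (leq_maxl N N') r rpq.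
  exists (g (maxn N N') + d - x r).
    by apply/vsubr_ge0; apply: vle_trans xd; exact: vle_abs.
  rewrite opprB addrA subrK opprD addrA.
  by apply: le_trans (ler_normB _ _) _; rewrite [e]splitr lerD.
Qed.

End AM_curves.

(** * Complex normed spaces as real normed spaces *)

(** An alias, so that the complex and the real structure coexist on the same
    vectors; every estimate below concerns the real one. *)
Definition realified (V : Type) : Type := V.

Section realified_normed.
Local Open Scope complex_scope.
Context {R : realType}.

HB.instance Definition _ (V : zmodType) := GRing.Zmodule.copy (realified V) V.

Section lmodule.
Variable V : lmodType R[i].

Definition realified_scale (a : R) (x : realified V) : realified V :=
  (a%:C *: (x : V)).

Let scaleA a b x : realified_scale a (realified_scale b x) = realified_scale (a * b) x.
Proof. by rewrite /realified_scale scalerA rmorphM. Qed.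

Let scale1 : left_id 1 realified_scale.
Proof. by move=> x; exact: scale1r. Qed.

Let scaleDr : right_distributive realified_scale +%R.
Proof. by move=> a x y; exact: scalerDr. Qed.

Let scaleDl x : {morph realified_scale^~ x : a b / a + b}.
Proof. by move=> a b; rewrite /realified_scale rmorphD scalerDl. Qed.

HB.instance Definition _ := GRing.Zmodule_isLmodule.Build R (realified V)
  scaleA scale1 scaleDr scaleDl.

Lemma realified_scaleE a (x : V) : a *: (x : realified V) = (a%:C *: x : V).
Proof. by []. Qed.

End lmodule.

Section norm.
Variable V : normedModType R[i].
Implicit Types x y : V.

Definition realified_norm (x : realified V) : R := complex.Re `|x : V|.

Lemma realified_normC x : (realified_norm x)%:C = `|x|.
Proof. by rewrite /realified_norm RRe_real// normr_real. Qed.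

Let normD (x y : realified V) :
  realified_norm (x + y) <= realified_norm x + realified_norm y.
Proof. by rewrite -lecR rmorphD /= !realified_normC ler_normD. Qed.

Let normZ (a : R) (x : realified V) : realified_norm (a *: x) = `|a| * realified_norm x.
Proof.
apply: complexI; rewrite rmorphM /= !realified_normC realified_scaleE normrZ.
by congr (_ * _); rewrite normc_def /= expr0n addr0 sqrtr_sqr.
Qed.

Let norm0 (x : realified V) : realified_norm x = 0 -> x = 0.
Proof. by move=> h; apply/(@normr0_eq0 _ V); rewrite -realified_normC h. Qed.

HB.instance Definition _ := Lmodule_isNormed.Build R (realified V) normD normZ norm0.

Lemma realified_normE x : `|x : realified V|%:C = `|x|.
Proof. exact: realified_normC. Qed.

Lemma realified_nbhs x : nbhs (x : realified V) = nbhs x.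
Proof.
apply/seteqP; split=> A.
  move=> /nbhs_ballP[e /= e0 he]; apply/nbhs_ballP; exists e%:C; first by rewrite /= ltcR.
  move=> y; rewrite -ball_normE /= => xy; apply: he; rewrite -ball_normE /=.
  by rewrite -ltcR realified_normE.
move=> /nbhs_ballP[e /= e0 he]; apply/nbhs_ballP.
have eE : e = (complex.Re e)%:C by rewrite RRe_real// gtr0_real.
exists (complex.Re e); first by rewrite /= -ltcR -eE.
move=> y; rewrite -ball_normE /= => xy; apply: he; rewrite -ball_normE /=.
by rewrite eE -(realified_normE (x - y)) ltcR.
Qed.

Lemma realified_nbhsP x (A : set V) : nbhs (x : realified V) A <-> nbhs x A.
Proof. by rewrite realified_nbhs. Qed.

Lemma realified_cvg (T : Type) (F : set_system T) (f : T -> V) (l : V) :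
  (f t : realified V) @[t --> F] --> (l : realified V) <-> f t @[t --> F] --> l.
Proof. by rewrite /cvg_to /= realified_nbhs. Qed.

End norm.

Section complete.
Variable V : completeNormedModType R[i].

Let realified_complete (F : set_system (realified V)) : ProperFilter F -> cauchy F -> cvg F.
Proof.
move=> FF /cauchyP Fc.
have : cvg (F : set_system V).
  apply/cauchy_cvgP/cauchyP => e e0.
  have eE : e = (complex.Re e)%:C by rewrite RRe_real// gtr0_real.
  have r0 : 0 < complex.Re e by rewrite -ltcR -eE.
  have [x Fx] := Fc _ r0; exists x; apply: filterS Fx => y.
  by rewrite -!ball_normE /= eE -(realified_normE (_ - _)) ltcR.
by move=> /cvg_ex[/= l Fl]; apply/cvg_ex; exists l; rewrite /= realified_nbhs.
Qed.

HB.instance Definition _ := Uniform_isComplete.Build (realified V) realified_complete.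

End complete.

Lemma realified_C0 (V : completeNormedModType R[i]) (T : R -> V -> V) :
  C0_semigroup T -> C0_semigroup (T : R -> realified V -> realified V).
Proof.
case=> h1 h2 h3 h4 h5; split => //.
- by move=> t t0 a x y; exact: h1.
- move=> t t0 x A /realified_nbhsP hA; apply/realified_nbhsP; exact: h2 t t0 x A hA.
- by move=> x; apply/realified_cvg; exact: h5.
Qed.

Lemma realified_continuous (V : completeNormedModType R[i]) (B : V -> V) :
  continuous (B : realified V -> realified V) <-> continuous B.
Proof.
by split=> h x A /realified_nbhsP /(h x) /realified_nbhsP.
Qed.

Lemma realified_generator (V : completeNormedModType R[i]) (T : R -> V -> V) :
  generator idfun (T : R -> realified V -> realified V) = generator (real_complex R) T.
Proof.
apply/seteqP; split=> -[x y]; rewrite /generator /=.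
  by move=> /realified_cvg.
by move=> h; apply/realified_cvg.
Qed.

End realified_normed.

(** * Eventually positive semigroups on the complexification *)

Section complexification_embedding.
Local Open Scope complex_scope.
Context {R : realType} {E : banachLatticeType R}.
Local Notation F := (realified (complexified E)).
Implicit Types (x y : E) (z w : F).

Definition of_real x : F := VComplex x 0.

Local Notation P := (complexified_positive_cone E : set F).

Lemma norm_of_real x : `|of_real x| = `|x|.
Proof.
by apply: complexI; rewrite realified_normE; exact: complexified_norm_real.
Qed.

Lemma realified_vReZ (a : R) z : vRe (a *: z : F) = a *: vRe z.
Proof. by rewrite realified_scaleE vReZ /= scale0r subr0. Qed.

Lemma realified_vImZ (a : R) z : vIm (a *: z : F) = a *: vIm z.
Proof. by rewrite realified_scaleE vImZ /= scale0r addr0. Qed.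

Lemma complexified_eq z w : vRe z = vRe w -> vIm z = vIm w -> z = w.
Proof. by case: z w => [a b] [c d] /= -> ->. Qed.

Lemma of_real_linear : linear of_real.
Proof.
move=> a x y; apply: complexified_eq.
  by rewrite vReD realified_vReZ.
by rewrite vImD realified_vImZ /= scaler0 addr0.
Qed.

Lemma of_realD x y : of_real (x + y) = of_real x + of_real y.
Proof. by apply: complexified_eq; rewrite ?vReD ?vImD/= ?addr0. Qed.

Lemma of_realZ a x : of_real (a *: x) = a *: of_real x.
Proof.
by apply: complexified_eq; rewrite ?realified_vReZ ?realified_vImZ/= ?scaler0.
Qed.

Lemma of_realB x y : of_real (x - y) = of_real x - of_real y.
Proof. by rewrite of_realD -scaleN1r of_realZ scaleN1r. Qed.

Lemma norm_vRe_realified z : `|vRe z| <= `|z|.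
Proof. by rewrite -lecR realified_normE; exact: norm_vRe_le. Qed.

Lemma vReB z w : vRe (z - w) = vRe z - vRe w. Proof. by []. Qed.

Lemma norm_vIm_realified z : `|vIm z| <= `|z|.
Proof. by rewrite -lecR realified_normE; exact: norm_vIm_le. Qed.

Lemma of_real_vRe z : vIm z = 0 -> of_real (vRe z) = z.
Proof. by move=> z0; apply: complexified_eq. Qed.

Lemma positive_cone_closed_cone : closed_cone P.
Proof.
split.
- move=> z zP.
  have h e : 0 < e -> exists2 w, P w & `|z - w| <= e.
    move=> e0; have [w [Pw zw]] : P `&` ball z e !=set0.
      by apply: zP; exact: nbhsx_ballx.
    exists w => //; rewrite -ball_normE /= in zw; exact: ltW.
  split.
    apply: vge0_approx => e /h[w [w0 _] zw]; exists (vRe w) => //.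
    by apply: le_trans zw; rewrite -vReB; exact: norm_vRe_realified.
  apply/eqP; rewrite -normr_le0; apply/ler_addgt0Pr => e /h[w [_ w0] zw].
  rewrite add0r; apply: le_trans zw; rewrite -[vIm z]subr0 -w0.
  exact: (norm_vIm_realified (z - w)).
- by split=> //=; exact: vle_refl.
- move=> z w [z0 zI] [w0 wI]; split; last by rewrite vImD zI wI addr0.
  by rewrite vReD -[0]addr0; exact: vleD.
- move=> a z a0 [z0 zI]; split; last by rewrite realified_vImZ zI scaler0.
  by rewrite realified_vReZ; exact: vscaler_ge0.
Qed.

Lemma of_real_positive x : 0 <=v x -> P (of_real x).
Proof. by move=> x0; split. Qed.

Lemma positive_cone_norm z w : P z -> P (w - z) -> `|z| <= `|w|.
Proof.
move=> [z0 zI] [wz0 _].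
rewrite -(of_real_vRe zI) norm_of_real (le_trans _ (norm_vRe_realified w))//.
by apply: vle_norm_ge0 => //; apply/vsubr_ge0.
Qed.

Lemma positive_cone_norm_between (v w1 w2 : F) : vIm v = 0 -> P (w1 - v) -> P (w2 + v) ->
  `|v| <= `|w1| + `|w2|.
Proof.
move=> vI [h1 _] [h2 _]; rewrite -(of_real_vRe vI) norm_of_real.
apply: le_trans (lerD (norm_vRe_realified w1) (norm_vRe_realified w2)).
rewrite -(norm_vabs (vRe w1)) -(norm_vabs (vRe w2)).
apply: vle_norm_absD; try exact: vabs_ge0.
  by apply: vle_trans (vle_abs _); apply/vsubr_ge0.
apply: vle_trans (vle_abs _); apply/vsubr_ge0; rewrite opprK; exact: h2.
Qed.

End complexification_embedding.

Section eventually_positive.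
Local Open Scope complex_scope.
Context {R : realType} {E : banachLatticeType R}.
Local Notation F := (realified (complexified E)).
Local Notation P := (complexified_positive_cone E : set F).
Local Notation j := (@of_real R E).
Hypothesis AM : AM_space E.
Variable S : R -> F -> F.
Hypothesis HS : C0_semigroup S.
Hypothesis S_iep : individually_eventually_positive P S.
Let A := generator idfun S.
Hypothesis S_res : forall mu, 0 <= mu -> exists B, resolvent_at A mu B.
Implicit Types (f g u : E) (s t r : R).

Let HP := @positive_cone_closed_cone R E.

Definition positive_orbit : set F := [set z | forall t, 0 <= t -> P (S t z)].

Lemma positive_orbit_closed_cone : closed_cone positive_orbit.
Proof.
split.
- move=> z zQ t t0; apply: closed_approx (ccone_closed HP) _ => e e0.
  have [M M0 hM] := linear_continuous_bound (C0_linear HS t0) (C0_continuous HS t0).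
  have [w [Qw zw]] : positive_orbit `&` ball z (e / M) !=set0.
    by have eM := divr_gt0 e0 M0; apply: zQ; exact: nbhsx_ballx.
  exists (S t w); first exact: Qw.
  rewrite -(C0_opB HS)// (le_trans (hM _))// mulrC -ler_pdivlMr//.
  by rewrite -ball_normE /= in zw; exact: ltW.
- by move=> t t0; rewrite (C0_op0 HS)//; exact: ccone0.
- move=> z w Qz Qw t t0; rewrite (C0_opD HS)//.
  by apply: (cconeD HP); [exact: Qz|exact: Qw].
- move=> a z a0 Qz t t0; rewrite (C0_opZ HS)//.
  by apply: (cconeZ HP) => //; exact: Qz.
Qed.

Lemma positive_orbit_invariant t z : 0 <= t -> positive_orbit z ->
  positive_orbit (S t z).
Proof.
move=> t0 Qz s s0; rewrite -(C0_add HS)//; apply: Qz; exact: addr_ge0.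
Qed.

Section with_resolvent.
Variable B : F -> F.
Hypothesis HB : resolvent_at A 0 B.

Lemma resolvent0_generator z : A (B z, - z).
Proof.
have [_ _ h] := HB; have [w Aw] := (h (B z) z).1 erefl.
rewrite scale0r sub0r => wz; have -> : - z = w by rewrite -wz opprK.
by [].
Qed.

Lemma resolvent0_orbit t z : 0 <= t -> B (S t z) = S t (B z).
Proof.
move=> t0; have [_ _ h] := HB; apply/h; exists (S t (- z)).
  exact: (generator_orbit HS t0 (resolvent0_generator (z := z))).
rewrite scale0r sub0r -scaleN1r -[- z]scaleN1r (C0_opZ HS)// scalerA.
by rewrite mulrNN mul1r scale1r.
Qed.

(** For q in [positive_orbit], both S(t) B q and B q - S(t) B q are positive, the
    latter as the integral of s |-> S(s) q over [0, t]. *)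
Lemma positive_orbit_resolvent_bound f : 0 <=v f ->
  exists M, forall t, 0 <= t -> `|S t (B (j f))| <= M.
Proof.
move=> f0; have [t0 t00 ht0] := S_iep (of_real_positive f0).
pose f1 := S t0 (j f).
have Qf1 : positive_orbit f1.
  by move=> t t_ge0; rewrite -(C0_add HS)//; apply: ht0; rewrite lerDr.
have QB : positive_orbit (B f1).
  apply: (resolvent0_preserves_cone HS positive_orbit_closed_cone _ S_res HB) => //.
  exact: positive_orbit_invariant.
have bound t : 0 <= t -> `|S t (B f1)| <= `|B f1|.
  move=> t_ge0; apply: positive_cone_norm; first exact: QB.
  have := generator_telescope HS (b := 0) HP (lexx 0) t_ge0
    (resolvent0_generator (z := f1)).
  rewrite scaler0 subr0 (C0_at0 HS); apply => s /andP[s0 _].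
  by rewrite subr0; exact: Qf1.
(* B f1 = S(t0) (B f), so the bound for f1 controls the orbit from t0 on. *)
have [M M1 hM] := C0_locally_bounded HS t0.
exists (`|B f1| + M * `|B (j f)|) => t t_ge0.
have [tt0|/ltW t0t] := leP t t0.
  by apply: le_trans (hM _ _ _) _; rewrite ?t_ge0// lerDr.
apply: le_trans (_ : `|B f1| <= _); last first.
  by rewrite lerDl mulr_ge0// (le_trans ler01).
have -> : S t (B (j f)) = S (t - t0) (B f1).
  by rewrite resolvent0_orbit// -(C0_add HS) ?subr_ge0// subrK.
by apply: bound; rewrite subr_ge0.
Qed.

Lemma orbit_resolvent_bounded : exists2 C, 0 < C &
  forall t, 0 <= t -> forall f, `|S t (B (j f))| <= C * `|f|.
Proof.
have [lB cB _] := HB; have [MB MB0 hMB] := linear_continuous_bound lB cB.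
apply: (@uniform_boundedness R E F R [set t | 0 <= t] (fun t f => S t (B (j f)))).
- move=> t t0 a x y.
  by rewrite of_real_linear lB (C0_linear HS t0).
- move=> t t0.
  have [M M0 hM] := linear_continuous_bound (C0_linear HS t0) (C0_continuous HS t0).
  exists (M * MB) => x; apply: le_trans (hM _) _; rewrite -mulrA ler_wpM2l ?(ltW M0)//.
  by apply: le_trans (hMB _) _; rewrite norm_of_real.
- move=> x.
  have [M1 h1] := positive_orbit_resolvent_bound (vabs_ge0 x).
  have x1 : 0 <=v vabs x + x.
    by rewrite -[X in X <=v _](addNr x); apply: vleD2r; exact: vle_absN.
  have [M2 h2] := positive_orbit_resolvent_bound x1.
  exists (M2 + M1) => t t0.
  have -> : x = (vabs x + x) - vabs x by rewrite addrC addrA addNr add0r.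
  have -> : B (j (vabs x + x - vabs x)) = B (j (vabs x + x)) - B (j (vabs x)).
    have := lB (-1) (j (vabs x)) (j (vabs x + x)).
    by rewrite !scaleN1r [- j _ + _]addrC -of_realB => ->; rewrite addrC.
  rewrite (C0_opB HS)//; apply: le_trans (ler_normB _ _) _.
  by apply: lerD; [exact: h2|exact: h1].
Qed.

End with_resolvent.

(** The sets of those x >= 0 with S(t) x >= 0 for t >= n cover the positive cone,
    so one of them contains a relative ball around some f0; rescaling f0 gives u. *)
Lemma uniformly_eventually_positive : exists (n : nat) u, 0 <=v u /\
  forall t f, n%:R <= t -> 0 <=v f ->
    P (S t (j u)) /\ P (S t (j (f + `|f| *: u))).
Proof.
have approx (D : set E) x e : closure D x -> 0 < e -> exists2 z, D z & `|x - z| <= e.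
  move=> cx e0; have [w [Dw xw]] : D `&` ball x e !=set0.
    by apply: cx; exact: nbhsx_ballx.
  by exists w => //; rewrite -ball_normE /= in xw; exact: ltW.
have := @closed_baire R E [set x | 0 <=v x]
  (fun n => [set x | forall t, n%:R <= t -> P (S t (j x))]).
case.
- move=> x cx; apply: vge0_approx => e e0; exact: approx cx e0.
- by exists 0; exact: vle_refl.
- move=> n x cx t nt; have t0 : 0 <= t by apply: le_trans nt.
  have [M M0 hM] := linear_continuous_bound (C0_linear HS t0) (C0_continuous HS t0).
  apply: closed_approx (ccone_closed HP) _ => e e0.
  have [z Qz xz] := approx _ _ _ cx (divr_gt0 e0 M0).
  exists (S t (j z)); first exact: Qz.
  rewrite -(C0_opB HS)// -of_realB (le_trans (hM _))// norm_of_real mulrC.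
  by rewrite -ler_pdivlMr.
- move=> x x0; have [t0 t00 h] := S_iep (of_real_positive x0).
  exists (Num.truncn t0).+1 => // t tn; apply: h; apply: le_trans tn.
  by apply: ltW; exact: truncnS_gt.
move=> n [f0 [e [f00 e0 hQ]]].
exists n, ((2 / e) *: f0); split.
  by apply: vscaler_ge0 => //; rewrite divr_ge0// ltW.
move=> t f nt f_ge0; have t0 : 0 <= t by apply: le_trans nt.
have Pu : P (S t (j ((2 / e) *: f0))).
  rewrite of_realZ (C0_opZ HS)//; apply: (cconeZ HP); first by rewrite divr_ge0// ltW.
  by apply: hQ => //; rewrite subrr normr0.
split=> //; have [->|fn0] := eqVneq f 0.
  by rewrite normr0 scale0r addr0 (C0_op0 HS)//; exact: ccone0.
have nf : 0 < `|f| by rewrite normr_gt0.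
(* The point at distance e / 2 from f0 in the direction of f. *)
pose y := f0 + (e / 2 / `|f|) *: f.
have fy : f + `|f| *: ((2 / e) *: f0) = (`|f| * (2 / e)) *: y.
  rewrite /y scalerDr addrC scalerA; congr (_ + _); rewrite scalerA.
  rewrite -[LHS]scale1r; congr (_ *: _); field.
  by rewrite !gt_eqF.
rewrite fy of_realZ (C0_opZ HS)//; apply: (cconeZ HP).
  by rewrite mulr_ge0// divr_ge0// ltW.
apply: hQ => //.
  rewrite /y /= -[0]addr0; apply: vleD => //; apply: vscaler_ge0 => //.
  by rewrite !divr_ge0// ltW.
rewrite /y opprD addrA subrr add0r normrN normrZ ger0_norm; last first.
  by rewrite !divr_ge0// ltW.
by rewrite divfK ?gt_eqF// ltr_pdivrMr// ltr_pMr// ltr1n.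
Qed.

(** Key step: if |S(r)| <= K on [a, t - a], then the norm of (t - 2a) S(t) f is
    at most a constant times K |f|, and the constant does not depend on t. The
    restriction of s and r = t - s to [a, t - a] makes S(s) almost positive and
    S(r) f real. *)
Lemma eventually_positive_bounded :
  exists2 K, 0 <= K & forall t f, 0 <= t -> 0 <=v f -> `|S t (j f)| <= K * `|f|.
Proof.
have [B HB] := S_res (lexx 0).
have [C C0 hC] := orbit_resolvent_bounded HB.
have [n [u [u0 hu]]] := uniformly_eventually_positive.
pose a : R := n.+1%:R.
have a0 : 0 < a by rewrite ltr0n.
have na : n%:R <= a by rewrite ler_nat.
(* Both S(r) u and S(r) (f + |f| u) are real. *)
have real_orbit r f : a <= r -> 0 <=v f -> vIm (S r (j f)) = 0.
  move=> ar f0; have r0 : 0 <= r by rewrite (le_trans (ltW a0)).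
  have [[_ h1] [_ h2]] := hu r f (le_trans na ar) f0.
  rewrite of_realD of_realZ (C0_opD HS)// (C0_opZ HS)// in h2.
  by move: h2; rewrite vImD realified_vImZ h1 scaler0 addr0.
pose D := 2 * C * (1 + 2 * `|u|).
have key t K f : 2 * a <= t -> 0 <= K ->
    (forall r g, a <= r <= t - a -> 0 <=v g -> `|S r (j g)| <= K * `|g|) ->
    0 <=v f -> exists2 w : F, `|w| <= D * (K * `|f|) &
      P (w - (t - 2 * a) *: S t (j f)).
  move=> at2 K0 hK f0.
  have Kf0 : 0 <= K * `|f| by rewrite mulr_ge0.
  have ata : a <= t - a by lra.
  have t0 : 0 <= t by lra.
  pose x r := vRe (S r (j f)).
  have xE r : a <= r -> j (x r) = S r (j f).
    by move=> ar; rewrite /x of_real_vRe// real_orbit.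
  have [g [g0 gK hg]] : exists g, [/\ 0 <=v g, `|g| <= K * `|f| &
      forall r, a <= r <= t - a -> x r <=v g].
    apply: (AM_curve_dominated AM ata Kf0).
      move=> r rat; apply: le_trans (norm_vRe_realified _) _; exact: hK.
    move=> e e0; have [d d0 hd] := C0_uniformly_continuous HS t (j f) e0.
    exists d => // r s /andP[ar rt] /andP[as' st] rs.
    rewrite /x -vReB; apply: le_trans (norm_vRe_realified _) _; apply: hd => //.
      by apply/andP; split; lra.
    by apply/andP; split; lra.
  (* The factor 2K|f| bounds the norm of g - S(t - s) f, to which the multiple
     of u makes S(s) apply positively. *)
  pose b := g + (2 * (K * `|f|)) *: u.
  have hb s : a <= s <= t - a -> P (S s (j b) - S t (j f)).
    move=> /andP[as' st]; have s0 : 0 <= s by lra.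
    have rat : a <= t - s <= t - a by apply/andP; split; lra.
    have [ar rt] := andP rat.
    pose d := g - x (t - s).
    have d0 : 0 <=v d by apply/vsubr_ge0; exact: hg.
    have dn : `|d| <= 2 * (K * `|f|).
      apply: le_trans (ler_normB _ _) _; rewrite [leRHS]mulr_natl mulr2n lerD//.
      by apply: le_trans (norm_vRe_realified _) _; exact: hK.
    have [h1 h2] := hu s d (le_trans na as') d0.
    have -> : S s (j b) - S t (j f) = S s (j (d + `|d| *: u)) +
        (2 * (K * `|f|) - `|d|) *: S s (j u).
      have -> : S t (j f) = S s (j (x (t - s))).
        by rewrite xE// -(C0_add HS) ?subr_ge0//; [rewrite addrC subrK|lra].
      rewrite -(C0_opB HS)// -(C0_opZ HS)// -(C0_opD HS)// -of_realB -of_realZ -of_realD.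
      congr (S s (j _)); rewrite /b /d scalerBl -!addrA; congr (_ + _).
      by rewrite addrC; congr (_ + _); rewrite addrC subrK.
    apply: (cconeD HP) => //; apply: (cconeZ HP) => //.
    by rewrite subr_ge0.
  have tel := generator_telescope HS HP (ltW a0) ata
    (resolvent0_generator HB (z := j b)) hb.
  exists (S a (B (j b)) - S (t - a) (B (j b))).
    apply: le_trans (ler_normB _ _) _.
    have bn : `|b| <= (1 + 2 * `|u|) * (K * `|f|).
      have -> : (1 + 2 * `|u|) * (K * `|f|) = K * `|f| + 2 * (K * `|f|) * `|u|.
        by ring.
      apply: le_trans (ler_normD _ _) _; apply: lerD => //.
      by rewrite normrZ ger0_norm// mulr_ge0.
    have h s : 0 <= s -> `|S s (B (j b))| <= C * ((1 + 2 * `|u|) * (K * `|f|)).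
      by move=> s0; apply: le_trans (hC _ s0 _) _; rewrite ler_wpM2l ?(ltW C0).
    have h1 := h a (ltW a0); have h2 : 0 <= t - a by lra.
    have := h _ h2; rewrite /D; lra.
  by have -> : t - 2 * a = t - a - a by lra.
(* If t - 2a >= L, then the factor t - 2a absorbs all the constants. *)
pose L := D * (1 + `|u|) + 1.
have D0 : 0 <= D by rewrite !mulr_ge0 ?addr_ge0 ?mulr_ge0 ?(ltW C0).
have L0 : 0 < L by rewrite ltr_wpDl// mulr_ge0// addr_ge0.
have step t K : 2 * a + L <= t -> 0 <= K ->
    (forall r g, 0 <= r <= t - a -> 0 <=v g -> `|S r (j g)| <= K * `|g|) ->
    forall f, 0 <=v f -> `|S t (j f)| <= K * `|f|.
  move=> at2 K0 hK f f0.
  have at2' : 2 * a <= t by lra.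
  have hK' r g : a <= r <= t - a -> 0 <=v g -> `|S r (j g)| <= K * `|g|.
    move=> /andP[ar rt]; apply: hK; rewrite rt andbT; lra.
  have [w1 w1n w1P] := key t K f at2' K0 hK' f0.
  have [w2 w2n w2P] := key t K u at2' K0 hK' u0.
  pose tau := t - 2 * a.
  have tL : L <= tau by rewrite /tau; lra.
  have t0 : 0 <= t by lra.
  have tau0 : 0 < tau by exact: lt_le_trans tL.
  have nat : n%:R <= t by lra.
  have [_ hf] := hu t f nat f0.
  (* The lower estimate: S(t) f >= - |f| S(t) u, and w2 dominates tau S(t) u. *)
  have hv : `|tau *: S t (j f)| <= `|w1| + `| `|f| *: w2|.
    apply: positive_cone_norm_between => //.
      by rewrite realified_vImZ real_orbit ?scaler0//; lra.
    have -> : `|f| *: w2 + tau *: S t (j f) =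
      `|f| *: (w2 - tau *: S t (j u)) + tau *: S t (j (f + `|f| *: u)).
      rewrite of_realD of_realZ (C0_opD HS)// (C0_opZ HS)//.
      rewrite scalerBr scalerDr !scalerA [tau * _]mulrC.
      by rewrite [X in _ = _ + X]addrC addrA subrK.
    apply: (cconeD HP); apply: (cconeZ HP) => //; exact: ltW.
  rewrite normrZ gtr0_norm// normrZ normr_id in hv.
  have hf' : tau * `|S t (j f)| <= D * (1 + `|u|) * (K * `|f|).
    apply: le_trans hv _; rewrite mulrDr mulr1 mulrDl lerD//.
    apply: le_trans (ler_wpM2l (normr_ge0 f) w2n) _.
    by rewrite le_eqVlt; apply/orP; left; apply/eqP; ring.
  rewrite -(ler_pM2l tau0); apply: le_trans hf' _.
  by rewrite ler_wpM2r ?mulr_ge0//; move: tL; rewrite /L; lra.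
pose t1 := 2 * a + L.
have [K K1 hK] := C0_locally_bounded HS t1.
have K0 : 0 <= K by apply: le_trans K1.
exists K => //.
have ind (k : nat) : forall t f, 0 <= t <= t1 + k%:R * a -> 0 <=v f ->
    `|S t (j f)| <= K * `|f|.
  elim: k => [|k ih] t f.
    by rewrite mul0r addr0 => ht _; rewrite -(norm_of_real f); exact: hK.
  move=> /andP[t_ge0 tk] f0.
  have [tk'|/ltW tk'] := leP t (t1 + k%:R * a); first by apply: ih; rewrite ?t_ge0.
  apply: step => //.
    by apply: le_trans tk'; rewrite lerDl mulr_ge0// ltW.
  move=> r g /andP[r0 rt]; apply: ih; rewrite r0/=; apply: le_trans rt _.
  by move: tk; rewrite -natr1 mulrDl mul1r; lra.
move=> t f t0 f0; apply: (ind (Num.truncn (t / a)).+1) => //; rewrite t0/=.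
apply: (@le_trans _ _ ((Num.truncn (t / a)).+1%:R * a)).
  by rewrite -ler_pdivrMr// ltW// truncnS_gt.
by rewrite lerDr /t1 addr_ge0 ?mulr_ge0// ltW.
Qed.

End eventually_positive.

(** * Spectral bound and growth bound *)

Section half_plane.
Local Open Scope complex_scope.
Context {R : realType} {V : completeNormedModType R[i]}.
Implicit Types (T : R -> V -> V) (l : R[i]).

Lemma generator_linear T a x y x' y' : C0_semigroup T ->
  generator (real_complex R) T (x, y) -> generator (real_complex R) T (x', y') ->
  generator (real_complex R) T (a *: x + x', a *: y + y').
Proof.
rewrite /generator /= => HT h h'.
have : a *: ((t^-1)%:C *: (T t x - x)) + (t^-1)%:C *: (T t x' - x') @[t --> 0^'+]
    --> a *: y + y'.
  by apply: cvgD h'; exact: cvgZl_tmp.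
apply: cvg_trans; apply: near_eq_cvg; near=> t.
have t0 : 0 <= t by [].
rewrite (C0_linear HT t0) !scalerA [a * _]mulrC -scalerA -scalerDr; congr (_ *: _).
by rewrite scalerBr opprD addrACA.
Unshelve. all: by end_near. Qed.

Lemma realified_norm_le (x y : V) (M : R) :
  `|x| <= M%:C * `|y| <-> `|x : realified V| <= M * `|y : realified V|.
Proof. by rewrite -(realified_normE x) -(realified_normE y) -rmorphM /= lecR. Qed.

Lemma realified_normZ l (x : V) :
  `|l *: x : realified V| = complex.Re `|l| * `|x : realified V|.
Proof.
apply: complexI; rewrite rmorphM /= !realified_normE normrZ.
by rewrite (RRe_real (normr_real l)).
Qed.

(** The complex multiplier e^(-lt) moves l to 0 and turns boundedness of
    e^(-wt) T(t) into exponential decay at the rate Re l - w. *)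
Lemma bounded_half_plane T w l : C0_semigroup T ->
  bounded_semigroup (real_complex R) (rescaled (real_complex R) w T) ->
  w < complex.Re l -> resolvent_set (generator (real_complex R) T) l.
Proof.
move=> HT [M hM] wl.
pose S : R -> realified V -> realified V := multiplied (cexpN l) T.
have HSV : C0_semigroup (multiplied (cexpN l) T) := C0_cexpN l HT.
have HS : C0_semigroup S := realified_C0 HSV.
have d0 : 0 < complex.Re l - w by rewrite subr_gt0.
have S_decay t (x : realified V) : 0 <= t ->
    `|S t x| <= `|M| * expR (- ((complex.Re l - w) * t)) * `|x|.
  move=> t0; have /realified_norm_le := hM t x t0.
  rewrite /rescaled /S /multiplied !realified_normZ norm_cexpN /=.
  have -> : Num.sqrt (expR (- w * t) ^+ 2 + 0 ^+ 2) = expR (- w * t).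
    by rewrite expr0n addr0 sqrtr_sqr ger0_norm// expR_ge0.
  move=> h; have -> : expR (- (complex.Re l * t)) =
      expR (- ((complex.Re l - w) * t)) * expR (- w * t).
    by rewrite -expRD; congr expR; ring.
  rewrite -[leLHS]mulrA [leRHS]mulrAC [leRHS]mulrC ler_wpM2l ?expR_ge0//.
  apply: le_trans h _.
  by rewrite ler_wpM2r// ler_norm.
have M0 := normr_ge0 M.
pose B : V -> V := @decay_inverse R _ S.
have BE x y : B y = x <-> generator (real_complex R) T (x, - y + l *: x).
  have h1 := decay_inverseE HS M0 d0 S_decay x y.
  rewrite /S realified_generator in h1.
  by apply: iff_trans h1 _; exact: generator_cexpN.
have BE' x y : B y = x <-> generator (real_complex R) (multiplied (cexpN l) T) (x, - y).
  by apply: iff_trans (BE x y) _; apply: iff_sym; exact: generator_cexpN.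
exists B; split.
- move=> a x y; apply/BE'; rewrite opprD -scalerN.
  by apply: generator_linear => //; exact/BE'.
- apply/realified_continuous; exact: (decay_inverse_continuous HS M0 d0 S_decay).
- move=> x y; split.
    move=> /BE h; exists (- y + l *: x) => //.
    by rewrite opprD addrCA subrr addr0 opprK.
  by move=> [Ax hx <-]; apply/BE; rewrite opprB subrK.
Qed.

End half_plane.

Lemma lt_ereal_between (R : realType) (a b : \bar R) : (a < b)%E ->
  exists2 w : R, (a < w%:E)%E & (w%:E < b)%E.
Proof.
case: a b => [r| |] [s| |] //= rs.
- exists ((r + s) / 2); rewrite lte_fin; move: rs; rewrite lte_fin; lra.
- by exists (r + 1); rewrite ?ltry// lte_fin ltrDl.
- by exists (s - 1); rewrite ?ltNyr// lte_fin gtrDl oppr_lt0.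
- by exists 0; rewrite ?ltry ?ltNyr.
Qed.

Section complex_case.
Local Open Scope complex_scope.
Context {R : realType} {E : banachLatticeType R}.
Hypothesis AM : AM_space E.
Variable T : R -> complexified E -> complexified E.
Hypothesis HT : C0_semigroup T.
Hypothesis T_iep : individually_eventually_positive (complexified_positive_cone E) T.
Local Notation F := (realified (complexified E)).
Local Notation A := (generator (real_complex R) T).

(** After rescaling by w the half line [0, oo[ is free of spectrum, and
    [eventually_positive_bounded] applies. It bounds S on positive vectors; a
    vector of E is a difference of positive vectors of norms at most 2|x| and
    |x|, which gives 3K, and the real and imaginary parts together give 6K. *)
Lemma bounded_above_spectral_bound w : (spectral_bound A < w%:E)%E ->
  bounded_semigroup (real_complex R) (rescaled (real_complex R) w T).
Proof.
move=> sw.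
pose S : R -> complexified E -> complexified E := rescaled (real_complex R) w T.
have SE : S = multiplied (cexpN w%:C) T.
  by apply/funext => t; apply/funext => x; rewrite /S /rescaled /multiplied cexpN_real.
have HSV : C0_semigroup S by rewrite SE; exact: C0_cexpN.
have HS : C0_semigroup (S : R -> F -> F) := realified_C0 HSV.
have S_iep : individually_eventually_positive (complexified_positive_cone E : set F)
    (S : R -> F -> F).
  move=> f /T_iep[t0 t00 h]; exists t0 => // t tt0.
  have -> : S t f = (expR (- w * t) *: (T t f : F) : F) by [].
  by apply: (cconeZ positive_cone_closed_cone); [exact: expR_ge0|exact: h].
have S_res mu : 0 <= mu -> exists B, resolvent_at
    (generator idfun (S : R -> F -> F)) mu B.
  move=> mu0; have : resolvent_set A (mu + w)%:C.
    apply: contrapT => nres; move: sw; apply/negP; rewrite -leNgt.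
    apply: ereal_sup_ge; exists (mu + w)%:E; last by rewrite lee_fin lerDr.
    by exists (mu + w)%:C.
  move=> [B [lB cB hB]]; exists B; split.
  - by move=> a x y; exact: lB.
  - exact/realified_continuous.
  - have mwE : (mu + w)%:C = mu%:C + w%:C :> R[i] by rewrite rmorphD.
    rewrite realified_generator SE => x y.
    apply: iff_trans (hB x y) _; split.
      move=> [Ax hx <-]; exists (Ax - w%:C *: x).
        by apply/generator_cexpN; rewrite subrK.
      by rewrite realified_scaleE opprB addrA -scalerDl.
    move=> [Ax /generator_cexpN hx <-]; exists (Ax + w%:C *: x) => //.
    by rewrite realified_scaleE mwE scalerDl opprD addrACA subrr addr0 addrC.
have [K K0 hK] := eventually_positive_bounded AM HS S_iep S_res.
exists (6 * K) => t z t0; apply/realified_norm_le.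
rewrite -/S.
have hr (x : E) : `|S t (of_real x) : F| <= 3 * K * `|x|.
  have {1}-> : x = (vabs x + x) - vabs x by rewrite addrC addrA addNr add0r.
  rewrite of_realB (C0_opB HS)//; apply: le_trans (ler_normB _ _) _.
  have x0 := vabs_ge0 x.
  have x1 : 0 <=v vabs x + x.
    by rewrite -[X in X <=v _](addNr x); apply: vleD2r; exact: vle_absN.
  have h1 := hK t _ t0 x0; have h2 := hK t _ t0 x1; rewrite norm_vabs in h1.
  have h3 : `|vabs x + x| <= `|x| + `|x|.
    by apply: le_trans (ler_normD _ _) _; rewrite norm_vabs.
  have h4 := ler_wpM2l K0 h3.
  by lra.
have zE : z = 'i *: of_real (vIm z) + of_real (vRe z).
  by case: z => a b; congr VComplex => /=;
    rewrite ?scale0r ?scale1r ?scaler0 ?subr0 ?add0r ?addr0.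
have -> : S t z = 'i *: S t (of_real (vIm z)) + S t (of_real (vRe z)).
  by rewrite {1}zE (C0_linear HSV t0).
apply: le_trans (ler_normD _ _) _.
have := realified_normZ 'i (S t (of_real (vIm z))).
rewrite normCi /= mul1r => ->.
have h1 := hr (vIm z); have h2 := hr (vRe z).
have K3 : 0 <= 3 * K by rewrite mulr_ge0.
have h3 := ler_wpM2l K3 (norm_vIm_realified z).
have h4 := ler_wpM2l K3 (norm_vRe_realified z).
by lra.
Qed.

Lemma spectral_bound_eq_growth_bound : spectral_bound A = growth_bound (real_complex R) T.
Proof.
apply/eqP; rewrite eq_le; apply/andP; split.
  apply: ge_ereal_sup => _ [l sl <-]; apply: le_ereal_inf_tmp => _ [w hw <-].
  rewrite lee_fin leNgt; apply/negP => wl; apply: sl.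
  exact: bounded_half_plane hw wl.
rewrite leNgt; apply/negP => /lt_ereal_between[w sw]; rewrite ltNge => /negP; apply.
by apply: ge_ereal_inf; exists w%:E => //; exists w => //; exact: bounded_above_spectral_bound.
Qed.

End complex_case.

Section real_case.
Local Open Scope complex_scope.
Context {R : realType} {E : banachLatticeType R}.
Variable T : R -> E -> E.
Hypothesis HT : C0_semigroup T.
Local Notation F := (realified (complexified E)).

Definition complexified_semigroup (t : R) (z : complexified E) : complexified E :=
  VComplex (T t (vRe z)) (T t (vIm z)).

Local Notation TC := complexified_semigroup.

Lemma realified_norm_le_ReIm (z : F) : `|z| <= `|vRe z| + `|vIm z|.
Proof. by rewrite -lecR realified_normE; exact: complexified_norm_le. Qed.

Lemma complexified_semigroup_linear t : 0 <= t -> linear (TC t).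
Proof.
move=> t0 a x y; congr VComplex.
  rewrite vReD vReZ (C0_opD HT)// (C0_opB HT)// !(C0_opZ HT)//.
by rewrite vImD vImZ !(C0_opD HT)// !(C0_opZ HT).
Qed.

Lemma C0_complexified_semigroup : C0_semigroup TC.
Proof.
split.
- exact: complexified_semigroup_linear.
- move=> t t0; have [M M0 hM] :=
    linear_continuous_bound (C0_linear HT t0) (C0_continuous HT t0).
  apply/realified_continuous; apply: (@linear_bound_continuous R F F _ (M + M)).
    by move=> a x y; exact: complexified_semigroup_linear.
  move=> z; apply: le_trans (realified_norm_le_ReIm _) _.
  rewrite mulrDl; apply: lerD; apply: le_trans (hM _) _;
    rewrite ler_wpM2l ?(ltW M0)//.
    exact: norm_vRe_realified.
  exact: norm_vIm_realified.
- by case=> x y; rewrite /TC !(C0_at0 HT).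
- by move=> s t z s0 t0; rewrite /TC !(C0_add HT).
- move=> z; apply/realified_cvg; apply/(@cvg_right0P R F) => e e0.
  have e2 : 0 < e / 2 by rewrite divr_gt0.
  have [d1 d10 h1] := C0_near0 HT (vRe z) e2.
  have [d2 d20 h2] := C0_near0 HT (vIm z) e2.
  exists (Num.min d1 d2) => [|t /andP[t0]]; first by rewrite lt_min d10.
  rewrite le_min => /andP[td1 td2].
  apply: le_trans (realified_norm_le_ReIm _) _; rewrite [e]splitr vReB.
  by apply: lerD; rewrite distrC; [apply: h1|apply: h2]; rewrite ltW.
Qed.

Lemma generator_complexified_semigroup :
  generator (real_complex R) TC = complexified_operator (generator idfun T).
Proof.
have q t (z w : F) : vRe (w - t^-1 *: ((TC t z : F) - z)) =
    vRe w - t^-1 *: (T t (vRe z) - vRe z).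
  by rewrite vReB realified_vReZ.
have q' t (z w : F) : vIm (w - t^-1 *: ((TC t z : F) - z)) =
    vIm w - t^-1 *: (T t (vIm z) - vIm z).
  by rewrite vImD vImN realified_vImZ.
rewrite -realified_generator; apply/seteqP; split=> -[z w] /=.
  move=> /cvg_right0P h; split; apply/cvg_right0P => e /h[d d0 hd];
    exists d => // t /hd /= {}hd; apply: le_trans hd.
    by rewrite -q; exact: norm_vRe_realified.
  by rewrite -q'; exact: norm_vIm_realified.
move=> [/cvg_right0P h1 /cvg_right0P h2]; apply/cvg_right0P => e e0.
have e2 : 0 < e / 2 by rewrite divr_gt0.
have [d1 d10 hd1] := h1 _ e2; have [d2 d20 hd2] := h2 _ e2.
exists (Num.min d1 d2) => [|t /andP[t0]]; first by rewrite lt_min d10.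
rewrite le_min => /andP[td1 td2] /=.
apply: le_trans (realified_norm_le_ReIm _) _; rewrite [e]splitr q q'.
by apply: lerD; [apply: hd1|apply: hd2]; rewrite t0.
Qed.

Lemma growth_bound_complexified_semigroup :
  growth_bound (real_complex R) TC = growth_bound idfun T.
Proof.
congr ereal_inf; apply/seteqP; split=> _ [w [M hM] <-]; exists w => //.
  exists M => t x t0; have /realified_norm_le := hM t (VComplex x 0) t0.
  have -> : rescaled (real_complex R) w TC t (VComplex x 0) =
      of_real (rescaled idfun w T t x).
    have -> : of_real (rescaled idfun w T t x) = expR (- w * t) *: of_real (T t x).
      by rewrite -of_realZ.
    by rewrite realified_scaleE; congr (_ *: VComplex _ _); rewrite (C0_op0 HT).
  by rewrite !norm_of_real.
exists (`|M| + `|M|) => t z t0; apply/realified_norm_le.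
have bnd x : `|rescaled idfun w T t x| <= `|M| * `|x|.
  by apply: le_trans (hM t x t0) _; rewrite ler_wpM2r// ler_norm.
apply: le_trans (realified_norm_le_ReIm _) _.
have -> : rescaled (real_complex R) w TC t z = expR (- w * t) *: (TC t z : F) by [].
rewrite realified_vReZ realified_vImZ mulrDl; apply: lerD;
  apply: le_trans (bnd _) _; rewrite ler_wpM2l//.
  exact: norm_vRe_realified.
exact: norm_vIm_realified.
Qed.

Lemma eventually_positive_complexified_semigroup :
  individually_eventually_positive (positive_cone E) T ->
  individually_eventually_positive (complexified_positive_cone E) TC.
Proof.
move=> h z [z0 zI]; have [t0 t00 ht] := h _ z0; exists t0 => // t tt0.
split; first exact: ht.
by rewrite /= zI (C0_op0 HT)// (le_trans t00).
Qed.

End real_case.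

Theorem theorem4 (R : realType) (E : banachLatticeType R) :
  AM_space E ->
  (forall T : R -> E -> E,
     C0_semigroup T ->
     individually_eventually_positive (positive_cone E) T ->
     spectral_bound (complexified_operator (generator idfun T)) =
     growth_bound idfun T) /\
  (forall T : R -> complexified E -> complexified E,
     C0_semigroup T ->
     individually_eventually_positive (complexified_positive_cone E) T ->
     spectral_bound (generator (real_complex R) T) =
     growth_bound (real_complex R) T).
Proof.
move=> AM; split=> T HT pT; last exact: spectral_bound_eq_growth_bound.
rewrite -generator_complexified_semigroup -(growth_bound_complexified_semigroup HT).
apply: (spectral_bound_eq_growth_bound AM); first exact: C0_complexified_semigroup.
exact: eventually_positive_complexified_semigroup.
Qed.
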